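(* Let $g\ge 0$ and $d\ge 1$ be integers and let $\Delta=(\Delta_u,\Delta_v,\Delta_w)$ be a triple of partitions of $d$ with $\#\Delta$ parts in total, where $\#\Delta+2g-2-d\ge0$. The moduli space $M_g^{\mathrm{trop}}(\mathcal L,\Delta)$ of tropical covers of $\mathcal L$ of genus $g$ and with ramification profile $\Delta$ is an abstract weighted polyhedral complex of pure dimension $\#\Delta+2g-2-d$.
   Context: **Abstract polyhedral complexes.** An abstract polyhedral complex with cells $X_1,\dots,X_N$ (open convex polyhedra in real vector spaces) is a topological space $X$ with continuous injective maps $i_k:\overline X_k\to X$ such that $X$ is the disjoint union of the $i_k(X_k)$ and the coordinate changes $i_k^{-1}\circ i_l$ are linear where defined. It is of pure dimension $n$ if every cell is contained in the closure of an $n$-dimensional cell and no cell has larger dimension; it is weighted if each maximal cell is equipped with a weight in $\mathbb Q$. **Tropical curves.** A tropical curve $\Gamma$ is a connected finite metric graph. One-valent vertices are called leaves, all other vertices inner vertices. An edge adjacent to a leaf is an end and has length $\infty$; the other edges are bounded and have a length $l(e)\in\mathbb R_{>0}$. Each end is marked by a number. Each inner vertex $V$ carries a genus $g_V\in\mathbb N$ ($0$ allowed), with $g_V\ge1$ if $\mathrm{val}(V)=2$, and finitely many labels such that the disjoint union of all labels is $\{1,\dots,r\}$ for some $r$. The genus of $\Gamma$ is $b^1(\Gamma)+\sum_Vg_V$. Curves are identified if there is a graph isometry preserving vertex genera, vertex labels and end markings. The combinatorial type is obtained by forgetting the lengths. **Covers.** $\mathcal L$ is the tropical curve with one inner vertex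 $c$ (genus $0$) and three ends $u,v,w$ adjacent to $c$. A cover of $\mathcal L$ is a tropical curve $\Gamma$ with a continuous map $h:\Gamma\to\mathcal L$ such that: (i) every (open) edge of $\Gamma$ maps into an edge of $\mathcal L$, and $h$ is affine linear there with nonzero integer slope, whose absolute value $w_e$ is the weight of $e$; (ii) (balancing) for each vertex $V$, the sum of the weights of the edges at $V$ mapped to a given direction at $h(V)$ is the same for every direction at $h(V)$ (three directions if $h(V)=c$, two otherwise); this sum is the local degree $\deg_hV$; (iii) for each inner vertex $V$ the RH-number $r_V:=(\mathrm{val}(V)+2g_V-2)-\deg_hV\cdot(\mathrm{val}(h(V))-2)$ is $\ge0$, where $\mathrm{val}(c)=3$ and $\mathrm{val}(h(V))=2$ if $h(V)\ne c$; (iv) each inner vertex $V$ has exactly $r_V$ labels. The degree $d$ of $h$ is the sum of the local degrees over the preimages of a point. The weights of the ends over $u,v,w$ give partitions $\Delta_u,\Delta_v,\Delta_w$ of $d$; $\Delta$ is the ramification profile. The parts of $\Delta$ are numbered, and the end marked $i$ has the weight, and maps to the ray, prescribed by the $i$-th part. An automorphism of $h$ is an automorphism $\phi$ of $\Gamma$ with $h\circ\phi=h$; $\mathrm{Aut}(h)$ is the automorphism group. **Types and cones.** The combinatorial type $\alpha$ of a cover is the combinatorial type of $\Gamma$ with all edge weights and the set of vertices mapped to $c$. Let $B$ be the number of bounded edges, and let $\Gamma'$ be obtained from $\Gamma$ by identifying all vertices over $c$. For each cycle in a basis of $H_1(\Gamma',\mathbb Z)$, written as a chain of directed edges, there is the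 equation $\sum_e\pm w_e\,l(e)=0$ (sign $+$ if $e$ is traversed away from $c$, $-$ otherwise, with multiplicity; common factors not cancelled) expressing that the image of the cycle closes up. These define an integer matrix $A_\alpha:\mathbb Z^B\to\mathbb Z^{b^1(\Gamma')}$, and the open cone $D_\alpha=\{x\in\mathbb R_{>0}^B:A_\alpha x=0\}$ parametrizes covers of type $\alpha$. $I_\alpha$ is the index of $A_\alpha(\mathbb Z^B)$ in $\mathbb Z^{b^1(\Gamma')}$. A point of the boundary of $\overline D_\alpha\subset\mathbb R^B_{\ge0}$ yields a contraction: each connected subgraph $\Gamma_0$ of edges of length zero, with vertices $V_1,\dots,V_k$, is replaced by one vertex of genus $\sum g_{V_i}+b^1(\Gamma_0)$ carrying all labels of the $V_i$. A type is trivalent if all vertices over $c$ have RH-number $0$ and all other inner vertices are trivalent of genus $0$. **Moduli space.** $M_g^{\mathrm{trop}}(\mathcal L,\Delta)$ is the union of all cones $D_\alpha$, $\alpha$ a trivalent type or a contraction of a trivalent type of genus $g$ covers with profile $\Delta$, glued by identifying boundary points of $\overline D_\alpha$ with the corresponding points of the cones of contractions. Its maximal cones are the $D_\alpha$ with $\alpha$ trivalent. **Weights.** The (triple) Hurwitz number $H^g_d(\Delta)$ is the number, weighted by $1/|\mathrm{Aut}(f)|$, of degree $d$ covers $f:C\to\mathbb P^1$ by smooth connected genus $g$ curves with all preimages of $0,1,\infty$ marked, ramification profiles $\Delta_u,\Delta_v,\Delta_w$ over $0,1,\infty$ (the $i$-th marked point having the ramification index given by the $i$-th part), simple ramification over $\#\Delta+2g-2-d$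 further fixed points and no other ramification. For a vertex $V$ over $c$ of a trivalent cover, $H_V:=H^{g_V}_{d'}(\Delta'_u,\Delta'_v,\Delta'_w)$, where $d'=\deg_hV$ and $\Delta'_u,\Delta'_v,\Delta'_w$ are the partitions given by the weights of the edges at $V$ mapping to $u,v,w$. The weight of a maximal cone is $\omega(D_\alpha):=\frac1{2^k}\cdot I_\alpha\cdot\prod_{V:h(V)=c}H_V$ with $2^k=|\mathrm{Aut}(h)|$, $h$ a cover of type $\alpha$. *)

(* Defs.v *)
From HB Require Import structures.
From mathcomp Require Import all_boot all_order all_algebra perm all_field finmap.
From mathcomp Require Import complex.
From mathcomp Require Import all_classical all_reals topology.

Set Implicit Arguments.
Unset Strict Implicit.
Unset Printing Implicit Defensive.

Import Order.TTheory GRing.Theory Num.Theory.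
Import numFieldTopology.Exports.

Local Open Scope classical_set_scope.
Local Open Scope ring_scope.
Local Open Scope quotient_scope.

(** * Abstract weighted polyhedral complexes *)

Section Complexes.
Variable R : realType.

(* "Open" is relative to the affine subspace given by the equations, which is
   the real vector space the polyhedron lives in. *)
Definition open_polyhedron N (P : set 'rV[R]_N) : Prop :=
  P !=set0 /\
  exists a b (A : 'M[R]_(N, a)) (c : 'rV[R]_a) (B : 'M[R]_(N, b)) (e : 'rV[R]_b),
    P = [set x | x *m A = c /\ forall j, (x *m B) 0 j < e 0 j].

(* W is the direction of the affine hull of P. *)
Definition has_dim N (P : set 'rV[R]_N) (n : nat) : Prop :=
  P !=set0 /\
  exists W : {vspace 'rV[R]_N},
    [/\ \dim W = n,
        forall x y, P x -> P y -> x - y \in W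
      & forall U : {vspace 'rV[R]_N},
          (forall x y, P x -> P y -> x - y \in U) -> (W <= U)%VS].

Variables (X : topologicalType) (I : Type) (amb : I -> nat).
Variable cell : forall k, set 'rV[R]_(amb k).
Variable emb : forall k, set_type (closure (@cell k)) -> X.
Variable omega : I -> option rat.

Definition cell_image k : set X := [set @emb k x | x in [set x : set_type (closure (@cell k)) | cell (set_val x)]].
Definition closed_cell_image k : set X := [set @emb k x | x in [set: set_type (closure (@cell k))]].

Definition polyhedral_complex : Prop :=
  [/\ finite_set [set: I],
      forall k, open_polyhedron (@cell k),
      forall k, continuous (@emb k) /\ injective (@emb k),
      forall p : X, exists! k, cell_image k p
    & forall k l, exists T : 'M[R]_(amb l, amb k),
        forall x y, @emb l x = @emb k y -> set_val y = set_val x *m T].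

Definition pure_dimensional (n : nat) : Prop :=
  (forall k, exists2 l, has_dim (@cell l) n & cell_image k `<=` closed_cell_image l) /\
  (forall k m, has_dim (@cell k) m -> (m <= n)%N).

Definition maximal_cell k : Prop :=
  forall l, cell_image k `<=` closed_cell_image l -> l = k.

(* [omega k] is [None] exactly when the cell k carries no weight. *)
Definition weighted : Prop := forall k, maximal_cell k <-> omega k.

Definition weighted_polyhedral_complex_of_pure_dim (n : nat) : Prop :=
  [/\ polyhedral_complex, weighted & pure_dimensional n].

End Complexes.

(** * Ramification profiles *)

(* The three rays u, v, w of L (over which the algebraic branch points 0, 1,
   oo lie) are the elements 0, 1, 2 of 'I_3. *)
Definition profile := 'I_3 -> seq nat.

Definition partition_of (d : nat) (s : seq nat) : Prop :=
  all (fun k => 0 < k)%N s /\ sumn s = d.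

(* The parts of a profile. They serve as the marks of the ends (and of the
   preimages of the branch points). *)
Definition mark (D : profile) := {a : 'I_3 & 'I_(size (D a))}.

Definition part (D : profile) (m : mark D) : nat := nth 0%N (D (tag m)) (tagged m).

Definition nparts (D : profile) : nat := \sum_a size (D a).

(** * Triple Hurwitz numbers *)

(* A smooth connected projective curve with a degree d map f to the projective
   line over the algebraically closed field C is given by its function field,
   an extension L of C(t) of degree d; the points of the curve are the places
   of L over C, i.e. the normalized discrete valuations that are trivial on C
   (Hartshorne I.6). The value at 0 is a convention making the valuation
   function unique. *)
Section FunctionFields.
Variable C : closedFieldType.

Definition ratfun : fieldType := {fraction {poly C}}.

Section Places.
Variable L : fieldExtType ratfun.

Definition ffconst (c : C) : L := (tofrac (c%:P) : ratfun)%:A.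

Definition place (v : L -> int) : Prop :=
  [/\ v 0 = 0,
      forall x y, x != 0 -> y != 0 -> v (x * y) = v x + v y,
      forall x y, x != 0 -> y != 0 -> x + y != 0 -> Num.min (v x) (v y) <= v (x + y),
      forall c, v (ffconst c) = 0
    & exists2 x, x != 0 & v x = 1].

(* [None] is the point oo of the projective line. *)
Definition parameter_at (b : option C) : ratfun :=
  if b is Some a then tofrac ('X - a%:P) else (tofrac 'X)^-1.

Definition pullback_ord (v : L -> int) (b : option C) : int :=
  v (parameter_at b)%:A.

Definition lies_over (v : L -> int) (b : option C) : Prop := 0 < pullback_ord v b.

(* Divisors are lists of places with multiplicities. *)
Definition is_divisor (A : seq ((L -> int) * int)) : Prop :=
  forall i, (i < size A)%N -> place (nth (fun=> 0, 0) A i).1.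

Definition mult_div (A : seq ((L -> int) * int)) (v : L -> int) : int :=
  \sum_(p <- A | `[< p.1 = v >]) p.2.

Definition deg_div (A : seq ((L -> int) * int)) : int := \sum_(p <- A) p.2.

Definition RR_space (A : seq ((L -> int) * int)) : set L :=
  [set x | x != 0 -> forall v, place v -> 0 <= v x + mult_div A v].

Definition has_free_family (S : set L) (k : nat) : Prop :=
  exists f : 'I_k -> L, (forall i, S (f i)) /\
    forall c : 'I_k -> C, \sum_i ffconst (c i) * f i = 0 -> forall i, c i = 0.

Definition RR_dim (A : seq ((L -> int) * int)) (k : nat) : Prop :=
  has_free_family (RR_space A) k /\ ~ has_free_family (RR_space A) k.+1.

(* Riemann's definition: g is the maximum of deg A - l(A) + 1 over all
   divisors A. *)
Definition has_genus (g : nat) : Prop :=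
  (forall A l, is_divisor A -> RR_dim A l -> deg_div A - l%:Z + 1 <= g%:Z) /\
  (exists A l, [/\ is_divisor A, RR_dim A l & deg_div A - l%:Z + 1 = g%:Z]).

End Places.

Record marked_cover (D : profile) := MarkedCover {
  cover_field : fieldExtType ratfun;
  marked_point : mark D -> cover_field -> int }.
Arguments marked_point {D} _ _ _.

Definition branch_point (a : 'I_3) : option C :=
  nth None [:: Some 0; Some 1; None] a.

(* The further branch points are 2, ..., s + 1; the count does not depend on
   this choice. *)
Definition simple_branch_point (j : nat) : option C := Some j.+2%:R.

Definition is_hurwitz_cover (g d : nat) (D : profile) (Y : marked_cover D) : Prop :=
  let s := (nparts D + 2 * g - 2 - d)%N in
  let L := cover_field Y in
  [/\ \dim {:L} = d,
      has_genus L g,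
      [/\ injective (marked_point Y),
          forall a v, place v ->
            (lies_over v (branch_point a) <->
             exists2 m : mark D, tag m = a & v = marked_point Y m)
        & forall m, place (marked_point Y m) /\
            pullback_ord (marked_point Y m) (branch_point (tag m)) = (part m)%:Z],
      forall j, (j < s)%N ->
        exists v : L -> int, [/\ place v, pullback_ord v (simple_branch_point j) = 2
          & forall v', place v' -> lies_over v' (simple_branch_point j) ->
              v' <> v -> pullback_ord v' (simple_branch_point j) = 1]
    & forall (b : option C) (v : L -> int), (forall a, b <> branch_point a) ->
        (forall j, (j < s)%N -> b <> simple_branch_point j) ->
        place v -> lies_over v b -> pullback_ord v b = 1].

Definition is_marked_iso (D : profile) (Y Z : marked_cover D)
    (f : 'AHom(cover_field Y, cover_field Z)) : Prop :=
  bijective f /\ forall m x, marked_point Z m (f x) = marked_point Y m x.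

Definition is_hurwitz_number (g d : nat) (D : profile) (q : rat) : Prop :=
  exists (N : nat) (Y : 'I_N -> marked_cover D) (a : 'I_N -> nat),
    [/\ forall i, is_hurwitz_cover g d (Y i),
        forall i j, (exists f, @is_marked_iso D (Y i) (Y j) f) -> i = j,
        forall Z, is_hurwitz_cover g d Z -> exists i f, @is_marked_iso D (Y i) Z f,
        forall i, ([set f | @is_marked_iso D (Y i) (Y i) f] #= `I_(a i))%card
      & q = \sum_i (a i)%:R^-1].

Definition hurwitz_number (g d : nat) (D : profile) : rat :=
  xget 0 [set q | is_hurwitz_number g d D q].

End FunctionFields.

(** * Tropical covers of L and their combinatorial types *)

(* The combinatorial type of a tropical cover h of L whose ends are marked by
   the parts of D. Vertices are the inner vertices of the source curve, edges
   are its bounded edges; the leaves are left implicit, [end_at m] being the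
   inner vertex adjacent to the end marked m. As h has nonzero slope on every
   edge, it directs each bounded edge away from c, from [src] to [tgt].
   [loc v] is [None] if h(v) = c and [Some a] if h(v) is in the interior of
   the ray a; together with the directions it is determined by the weights, the
   end markings and the set of vertices over c. *)
Record ctype (D : profile) := CType {
  nvert : nat;
  nedge : nat;
  src : 'I_nedge -> 'I_nvert;
  tgt : 'I_nedge -> 'I_nvert;
  end_at : mark D -> 'I_nvert;
  genus : 'I_nvert -> nat;
  labels : 'I_nvert -> {fset nat};
  weight : 'I_nedge -> nat;
  loc : 'I_nvert -> option 'I_3 }.

HB.instance Definition _ D := gen_eqMixin (ctype D).
HB.instance Definition _ D := gen_choiceMixin (ctype D).

Section Types.
Variable D : profile.
Implicit Type A : ctype D.

Definition valence A (v : 'I_(nvert A)) : nat :=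
  #|[pred e | src e == v]| + #|[pred e | tgt e == v]| + #|[pred m | end_at A m == v]|.

Definition adj A : rel 'I_(nvert A) :=
  [rel a b | [exists e, (src e == a) && (tgt e == b) || (src e == b) && (tgt e == a)]].

(* The ends do not contribute to the first Betti number of the curve. *)
Definition total_genus A : nat := (nedge A).+1 - nvert A + \sum_v @genus _ A v.

Definition tropical_curve A : Prop :=
  [/\ (0 < nvert A)%N /\ (forall a b, connect (@adj A) a b),
      forall v, @valence A v != 1%N,
      forall v, @valence A v = 2%N -> (1 <= genus v)%N,
      forall v v', v != v' -> [disjoint labels v & @labels _ A v']%fset
    & exists r : nat, forall k : nat, (0 < k <= r)%N <-> exists v, k \in @labels _ A v].

(* Directions at a point of L: [None] points towards c, [Some a] points away
   from c along the ray a. *)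
Definition directions (p : option 'I_3) : seq (option 'I_3) :=
  if p is Some a then [:: None; Some a] else [seq Some a | a <- enum 'I_3].

Definition weights_towards A (v : 'I_(nvert A)) (delta : option 'I_3) : seq nat :=
  if delta is Some a then
    [seq weight e | e <- enum 'I_(nedge A) & (src e == v) && (loc (tgt e) == Some a)] ++
    [seq part m | m <- enum {: mark D} & (end_at A m == v) && (tag m == a)]
  else [seq weight e | e <- enum 'I_(nedge A) & tgt e == v].

Definition balanced A (v : 'I_(nvert A)) : Prop :=
  {in directions (loc v) &, forall delta delta',
     sumn (weights_towards v delta) = sumn (weights_towards v delta')}.

Definition local_degree A (v : 'I_(nvert A)) : nat :=
  sumn (weights_towards v (Some (odflt ord0 (loc v)))).

Definition RH_number A (v : 'I_(nvert A)) : int :=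
  (valence v + 2 * genus v)%:Z - 2 - (local_degree v)%:Z * ((size (directions (loc v)))%:Z - 2).

Section Metric.
Variable R : realType.

(* The curve of type A with bounded edges of lengths x, with the map that sends
   v to the point at distance p v from c on the ray given by [loc v], and that
   is affine linear of slope [weight e] resp. [part m] on the edges and ends,
   is a degree d cover of L. *)
Definition is_cover (d : nat) A (x : 'rV[R]_(nedge A)) (p : 'I_(nvert A) -> R) : Prop :=
  tropical_curve A /\
  [/\ forall e, [/\ 0 < x 0 e, (0 < weight e)%N & p (tgt e) = p (src e) + (weight e)%:R * x 0 e],
      forall v, 0 <= p v /\ (p v = 0 <-> loc v = None),
      (forall e, loc (tgt e) != None /\ @loc _ A (src e) \in [:: None; loc (tgt e)]) /\
      (forall m, loc (end_at A m) \in [:: None; Some (tag m)])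
    & [/\ forall v, @balanced A v,
          forall v, 0 <= @RH_number A v,
          forall v, #|` @labels _ A v|%:Z = RH_number v
        & (\sum_(v | @loc _ A v == None) local_degree v)%N = d]].

Definition is_type (d : nat) A : Prop := exists x p, @is_cover d A x p.

(** ** Cones *)

(* The vertices of the curve with all vertices over c identified. *)
Definition glue_center A (v : 'I_(nvert A)) : option 'I_(nvert A) :=
  if loc v is Some _ then Some v else None.

Definition glued_b1 A : nat :=
  (nedge A).+1 - #|[pred p | [exists v, @glue_center A v == p]]|.

(* 1-cycles of the glued graph, as integer combinations of the bounded edges
   directed away from c. *)
Definition is_cycle A (z : 'rV[int]_(nedge A)) : Prop :=
  forall p, \sum_(e | glue_center (tgt e) == p) z 0 e = \sum_(e | glue_center (src e) == p) z 0 e.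

Definition is_cycle_basis A (Z : 'M[int]_(glued_b1 A, nedge A)) : Prop :=
  (forall j, is_cycle (row j Z)) /\
  (forall z, is_cycle z -> exists! y : 'rV[int]_(glued_b1 A), z = y *m Z).

Definition cycle_basis A : 'M[int]_(glued_b1 A, nedge A) :=
  xget 0 [set Z | @is_cycle_basis A Z].

(* The matrix A_alpha; the coefficient of the cycle basis carries the sign and
   multiplicity with which an edge is traversed. *)
Definition cycle_matrix A : 'M[int]_(glued_b1 A, nedge A) :=
  \matrix_(j, e) (cycle_basis A j e * (weight e)%:Z).

Definition cone A : set 'rV[R]_(nedge A) :=
  [set x : 'rV[R]_(nedge A) | (forall e, 0 < x 0 e) /\
           map_mx intr (cycle_matrix A) *m x^T = 0 :> 'cV[R]_(glued_b1 A)].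

(** ** Contractions *)

Section Contraction.
Variables (A : ctype D) (Z : {set 'I_(nedge A)}).

Definition adjZ : rel 'I_(nvert A) :=
  [rel a b | [exists e in Z, (src e == a) && (tgt e == b) || (src e == b) && (tgt e == a)]].

(* The contracted subgraphs are the connected components of the graph with
   edges Z; they are represented by their [fingraph.root]. *)
Definition comp_roots : {set 'I_(nvert A)} := finset (roots adjZ).

Lemma root_comp v : fingraph.root adjZ v \in comp_roots.
Proof.
have csym : connect_sym adjZ.
  apply: sym_connect_sym => a b; apply: eq_existsb => e.
  by rewrite orbC.
by rewrite inE /=; exact: roots_root.
Qed.

Definition comp_of (v : 'I_(nvert A)) : 'I_#|comp_roots| :=
  enum_rank_in (root_comp v) (fingraph.root adjZ v).

Definition comp_b1 (c : 'I_#|comp_roots|) : nat :=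
  #|[pred e in Z | comp_of (src e) == c]|.+1 - #|[pred v | comp_of v == c]|.

Definition contraction : ctype D := {|
  nvert := #|comp_roots|;
  nedge := #|~: Z|;
  src := fun e => comp_of (src (enum_val e));
  tgt := fun e => comp_of (tgt (enum_val e));
  end_at := fun m => comp_of (end_at A m);
  genus := fun c => (\sum_(v | comp_of v == c) genus v + comp_b1 c)%N;
  labels := fun c => (\bigcup_(v | comp_of v == c) labels v)%fset;
  weight := fun e => weight (enum_val e);
  loc := fun c => if [exists v, (comp_of v == c) && (loc v == None)] then None
                  else loc (enum_val c) |}.

End Contraction.

Definition zero_edges A (x : 'rV[R]_(nedge A)) : {set 'I_(nedge A)} :=
  finset (fun e => x 0 e == 0).

Definition remaining_lengths A (x : 'rV[R]_(nedge A)) :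
    'rV[R]_(nedge (contraction (zero_edges x))) :=
  \row_e x 0 (enum_val e).

(** ** Isomorphisms *)

Definition is_type_iso A B (f : 'I_(nvert A) -> 'I_(nvert B))
    (h : 'I_(nedge A) -> 'I_(nedge B)) : Prop :=
  [/\ bijective f, bijective h,
      forall e, [/\ src (h e) = f (src e), tgt (h e) = f (tgt e) & weight (h e) = weight e],
      forall m, end_at B m = f (end_at A m)
    & forall v, [/\ genus (f v) = genus v, labels (f v) = labels v & loc (f v) = loc v]].

Definition type_iso A B : Prop := exists f h, @is_type_iso A B f h.

(* Isomorphisms of covers, i.e. isometries of the source curves commuting with
   the maps to L: as every vertex is joined to a vertex over c, the map is
   determined by [loc], the directions, the weights and the lengths. *)
Definition is_cover_iso A (x : 'rV[R]_(nedge A)) B (y : 'rV[R]_(nedge B)) f h : Prop :=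
  @is_type_iso A B f h /\ forall e, y 0 (h e) = x 0 e.

Definition cover_iso A (x : 'rV[R]_(nedge A)) B (y : 'rV[R]_(nedge B)) : Prop :=
  exists f h, is_cover_iso x y f h.

Lemma cover_iso_refl A (x : 'rV[R]_(nedge A)) : cover_iso x x.
Proof. by exists id, id; split=> //; split=> //; exists id. Qed.

Lemma cover_iso_sym A (x : 'rV[R]_(nedge A)) B (y : 'rV[R]_(nedge B)) :
  cover_iso x y -> cover_iso y x.
Proof.
move=> [f [h [[[f' fK f'K] [h' hK h'K] He Hm Hv] Hl]]].
exists f', h'; split; last by move=> e; rewrite -Hl h'K.
split; [by exists f|by exists h| | |].
- move=> e; have [Hs Ht Hw] := He (h' e).
  by rewrite h'K in Hs Ht Hw; rewrite Hs Ht Hw !fK.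
- by move=> m; rewrite Hm fK.
- by move=> v; have [<- <- <-] := Hv (f' v); rewrite f'K.
Qed.

Lemma cover_iso_trans A (x : 'rV[R]_(nedge A)) B (y : 'rV[R]_(nedge B))
    E (z : 'rV[R]_(nedge E)) :
  cover_iso x y -> cover_iso y z -> cover_iso x z.
Proof.
move=> [f [h [[bf bh He Hm Hv] Hl]]] [f2 [h2 [[bf2 bh2 He2 Hm2 Hv2] Hl2]]].
exists (f2 \o f), (h2 \o h); split; last by move=> e; rewrite /= Hl2 Hl.
split; [exact: bij_comp|exact: bij_comp| | |].
- move=> e /=; have [-> -> ->] := He2 (h e).
  by have [-> -> ->] := He e.
- by move=> m; rewrite Hm2 Hm.
- by move=> v /=; have [-> -> ->] := Hv2 (f v); have [-> -> ->] := Hv v.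
Qed.

End Metric.

Lemma type_iso_cover_iso (R : realType) A B :
  type_iso A B <-> cover_iso (const_mx 0 : 'rV[R]_(nedge A)) (const_mx 0 : 'rV[R]_(nedge B)).
Proof.
split=> -[f [h H]]; exists f, h; last by case: H.
by split=> // e; rewrite !mxE.
Qed.

End Types.

(** * The moduli space *)

Section Moduli.
Variables (R : realType) (g d : nat) (D : profile).
Implicit Type A : ctype D.

Definition trivalent A : Prop :=
  forall v, if @loc _ A v is Some _ then valence v = 3%N /\ genus v = 0%N else RH_number v = 0.

Definition genus_type A : Prop := is_type R d A /\ total_genus A = g.

Definition moduli_types : set (ctype D) :=
  [set A | genus_type A /\
     (trivalent A \/
      exists B (x : 'rV[R]_(nedge B)),
        [/\ genus_type B, trivalent B, closure (@cone D R B) x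
          & type_iso (contraction (zero_edges x)) A])].

Definition closed_cone (A : set_type moduli_types) : topologicalType :=
  set_type (closure (@cone D R (set_val A))).

Definition closed_cones : topologicalType := {A : set_type moduli_types & closed_cone A}.

Definition contracted_type (p : closed_cones) : ctype D :=
  contraction (zero_edges (set_val (tagged p))).

Definition contracted_lengths (p : closed_cones) : 'rV[R]_(nedge (contracted_type p)) :=
  remaining_lengths (set_val (tagged p)).

Definition same_cover (p q : closed_cones) : bool :=
  `[< cover_iso (contracted_lengths p) (contracted_lengths q) >].

Lemma same_cover_equiv : equiv_class_of same_cover.
Proof.
split; first by move=> p; apply/asboolP; exact: cover_iso_refl.
- by move=> p q; apply: asbool_equiv_eq; split; exact: cover_iso_sym.
- move=> q p r /asboolP pq /asboolP qr; apply/asboolP.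
  exact: cover_iso_trans pq qr.
Qed.

Canonical same_cover_equivRel := EquivRelPack same_cover_equiv.

Definition moduli_space : topologicalType :=
  quotient_topology {eq_quot same_cover_equivRel}.

(* The cells are indexed by the isomorphism classes of combinatorial types. *)
Definition same_type (A B : set_type moduli_types) : bool :=
  `[< type_iso (set_val A) (set_val B) >].

Lemma same_type_equiv : equiv_class_of same_type.
Proof.
split.
- by move=> A; apply/asboolP/(type_iso_cover_iso R); exact: cover_iso_refl.
- move=> A B; apply: asbool_equiv_eq.
  by split=> /(type_iso_cover_iso R)/cover_iso_sym/(type_iso_cover_iso R).
- move=> B A E /asboolP/(type_iso_cover_iso R) AB /asboolP/(type_iso_cover_iso R) BE.
  by apply/asboolP/(type_iso_cover_iso R); exact: cover_iso_trans AB BE.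
Qed.

Canonical same_type_equivRel := EquivRelPack same_type_equiv.

Definition type_class : Type := {eq_quot same_type_equivRel}.

Definition class_type (k : type_class) : set_type moduli_types :=
  repr (k : {eq_quot same_type_equivRel}).

Definition moduli_amb (k : type_class) : nat := nedge (set_val (class_type k)).

Definition moduli_cell (k : type_class) : set 'rV[R]_(moduli_amb k) :=
  @cone D R (set_val (class_type k)).

Definition moduli_emb (k : type_class) (x : set_type (closure (@moduli_cell k))) :
    moduli_space :=
  \pi_({eq_quot same_cover_equivRel})
    (existT closed_cone (class_type k) (x : closed_cone (class_type k))).

(** ** Weights *)

Definition num_aut A (x : 'rV[R]_(nedge A)) : nat :=
  #|[pred s : ({perm 'I_(nvert A)} * {perm 'I_(nedge A)})%type |
      `[< is_cover_iso x x s.1 s.2 >]]|.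

Definition is_index m n (M : 'M[int]_(m, n)) (k : nat) : Prop :=
  exists r : 'I_k -> 'cV[int]_m,
    forall y : 'cV[int]_m, exists! i, exists z : 'cV[int]_n, y - r i = M *m z.

Definition lattice_index m n (M : 'M[int]_(m, n)) : nat := xget 0%N [set k | is_index M k].

Definition vertex_hurwitz A (v : 'I_(nvert A)) : rat :=
  hurwitz_number R[i] (genus v) (local_degree v) (fun a => weights_towards v (Some a)).

(* The cover h of type A is chosen arbitrarily: all covers of a type have the
   same automorphism group, as lengths and positions are fixed by automorphisms
   of the type. *)
Definition cone_weight A : rat :=
  (num_aut (xget 0 (@cone D R A)))%:R^-1 * (lattice_index (cycle_matrix A))%:R *
  \prod_(v | @loc _ A v == None) vertex_hurwitz v.

Definition moduli_weight (k : type_class) : option rat :=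
  let A := set_val (class_type k) in
  if `[< trivalent A >] then Some (cone_weight A) else None.

End Moduli.

(* Main.v *)
From mathcomp Require Import all_boot all_order all_algebra finmap.
From mathcomp Require Import all_classical all_reals topology.
From mathcomp Require Import zify ring lra.
Require Import Defs.

(* A point x of the closed cone of a type A amounts to nonnegative edge lengths
   together with a position on its ray for every vertex, zero over c, such that
   the position increases by w_e l(e) along each edge e directed away from c.
   Every vertex not over c is the end of such an edge and, by balancing, has
   RH-number at least 1, hence carries a label. Contracting the edges of length
   zero adds up RH-numbers and local degrees over the contracted subgraphs, so it
   yields a cover again, and the position of a labelled vertex is not changed.
   So the positions of the vertices not over c, i.e. the lengths, can be read off
   from the contracted cover: the closed cones embed, and their coordinate changes
   are linear. The dimension of a cone is the number of vertices not over c, and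
   the RH-numbers add up to #D + 2g - 2 - d; all of these numbers are 1 or 0
   exactly for trivalent types, which therefore have the maximal cones. *)

Set Implicit Arguments.
Unset Strict Implicit.
Unset Printing Implicit Defensive.

Import Order.TTheory GRing.Theory Num.Theory.
Import numFieldTopology.Exports.

Local Open Scope ring_scope.

(** * Covers of a fixed type *)

(** Two choices made in the definitions shape the proof. [cycle_basis] is picked by [xget] with
    default 0, so nothing is known about the equations of a cone until an integral cycle basis is
    exhibited. The fundamental cycles of a spanning tree provide one; from then on the closing
    conditions are replaced by the existence of a potential, i.e. of positions on the rays.
    Secondly, the vertices and edges of [contraction (zero_edges x)] are enumerated from [x], so the
    contracted types of two points cannot be compared by equality. Contraction is therefore treated
    as a relation [is_contraction], which is unique up to isomorphism, closed under composition and
    contains the isomorphisms as the contractions of no edge. With lengths added it becomes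
    [degenerates], and two points are glued exactly when they have a common degeneration. Genera are
    defined by truncated subtraction, so connectedness also has to supply the inequalities that make
    these subtractions exact. *)

Lemma big_fiber (T : Type) (idx : T) (op : Monoid.com_law idx) (I J : finType)
    (f : I -> J) (P : pred J) (Q : pred I) (F : I -> T) :
  \big[op/idx]_(j | P j) \big[op/idx]_(i | (f i == j) && Q i) F i =
  \big[op/idx]_(i | P (f i) && Q i) F i.
Proof.
rewrite [RHS](partition_big f P); last by move=> i /andP[].
apply: eq_bigr => j Pj; apply: eq_bigl => i.
by case: eqP => [->|_]; rewrite ?Pj ?andbT ?andbF.
Qed.

Lemma big_fiberT (T : Type) (idx : T) (op : Monoid.com_law idx) (I J : finType)
    (f : I -> J) (P : pred J) (F : I -> T) :
  \big[op/idx]_(j | P j) \big[op/idx]_(i | f i == j) F i = \big[op/idx]_(i | P (f i)) F i.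
Proof.
have := big_fiber op f P xpredT F.
under eq_bigr => j _ do under eq_bigl => i do rewrite andbT.
by under [in RHS]eq_bigl => i do rewrite andbT.
Qed.

Lemma card_fiber (I J : finType) (f : I -> J) (P : pred J) (Q : pred I) :
  (\sum_(j | P j) #|[pred i | (f i == j) && Q i]| = #|[pred i | P (f i) && Q i]|)%N.
Proof.
transitivity (\sum_(j | P j) \sum_(i | (f i == j) && Q i) 1)%N.
  by apply: eq_bigr => j _; rewrite sum1_card.
by rewrite big_fiber sum1_card.
Qed.

Lemma card_fiberT (I J : finType) (f : I -> J) (P : pred J) :
  (\sum_(j | P j) #|[pred i | f i == j]| = #|[pred i | P (f i)]|)%N.
Proof.
transitivity (\sum_(j | P j) \sum_(i | f i == j) 1)%N.
  by apply: eq_bigr => j _; rewrite sum1_card.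
by rewrite big_fiberT sum1_card.
Qed.

Section OneType.
Variables (D : profile) (A : ctype D).
Implicit Type v : 'I_(nvert A).

Definition outflow v (a : 'I_3) : nat :=
  (\sum_(e | (src e == v) && (loc (tgt e) == Some a)) weight e +
   \sum_(m | (end_at A m == v) && (tag m == a)) part m)%N.

Definition inflow v : nat := (\sum_(e | tgt e == v) @weight _ A e)%N.

Lemma sumn_outflow v a : sumn (weights_towards v (Some a)) = outflow v a.
Proof.
rewrite /weights_towards sumn_cat !sumnE !big_map !big_filter /outflow.
by rewrite !big_enum_cond.
Qed.

Lemma sumn_inflow v : sumn (weights_towards v None) = inflow v.
Proof. by rewrite /weights_towards sumnE big_map big_filter big_enum_cond. Qed.

Lemma local_degreeE v : local_degree v = outflow v (odflt ord0 (loc v)).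
Proof. by rewrite /local_degree sumn_outflow. Qed.

Lemma RH_center v : loc v = None ->
  RH_number v = (valence v + 2 * genus v)%:Z - 2 - (local_degree v)%:Z.
Proof. by move=> lv; rewrite /RH_number lv /= size_map size_enum_ord mulr1. Qed.

Lemma RH_ray v a : loc v = Some a -> RH_number v = (valence v + 2 * genus v)%:Z - 2.
Proof. by move=> lv; rewrite /RH_number lv /= mulr0 subr0. Qed.

(** One formula for vertices over c and on rays, so that it can be summed over arbitrary sets of
    vertices. *)
Lemma RH_split v : RH_number v =
  (valence v + 2 * genus v)%:Z - 2 - ((loc v == None) * local_degree v)%N%:Z.
Proof.
case lv: (loc v) => [a|]; first by rewrite (RH_ray lv) mul0n subr0.
by rewrite RH_center // mul1n.
Qed.

Lemma balanced_center v : loc v = None -> balanced v ->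
  forall a, outflow v a = local_degree v.
Proof.
move=> lv bal a; rewrite local_degreeE lv /= -!sumn_outflow; apply: bal; rewrite lv /=.
  by rewrite map_f ?mem_enum.
by rewrite map_f ?mem_enum.
Qed.

Lemma balanced_ray v a : loc v = Some a -> balanced v -> outflow v a = inflow v.
Proof.
by move=> lv bal; rewrite -sumn_outflow -sumn_inflow; apply: bal; rewrite lv !inE eqxx ?orbT.
Qed.

End OneType.

(** * Balancing, RH-numbers and positions on a given cover *)

Section Cover.
Variables (R : realType) (D : profile) (d : nat) (A : ctype D).
Variables (x0 : 'rV[R]_(nedge A)) (p0 : 'I_(nvert A) -> R).
Hypotheses (hd : (0 < d)%N) (hD : forall a, partition_of d (D a)).
Hypothesis cov : is_cover d x0 p0.
Implicit Type v : 'I_(nvert A).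
Implicit Type e : 'I_(nedge A).

Lemma part_gt0 (m : mark D) : (0 < part m)%N.
Proof.
have [/all_nthP H _] := hD (tag m); apply: H; exact: ltn_ord.
Qed.

Lemma length_gt0 e : 0 < x0 0 e.
Proof. by case: cov => _ [] /(_ e)[]. Qed.

Lemma weight_gt0 e : (0 < weight e)%N.
Proof. by case: cov => _ [] /(_ e)[]. Qed.

Lemma cover_pot e : p0 (tgt e) = p0 (src e) + (weight e)%:R * x0 0 e.
Proof. by case: cov => _ [] /(_ e)[]. Qed.

Lemma cover_pot_lt e : p0 (src e) < p0 (tgt e).
Proof. by rewrite cover_pot ltrDl mulr_gt0 ?length_gt0// ltr0n weight_gt0. Qed.

Lemma cover_pot_eq0 v : p0 v = 0 <-> loc v = None.
Proof. by case: cov => _ [] _ /(_ v)[]. Qed.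

Lemma loc_tgt e : loc (tgt e) != None.
Proof. by case: cov => _ [] _ _ [] /(_ e)[]. Qed.

Lemma loc_src e : loc (src e) = None \/ loc (src e) = loc (tgt e).
Proof.
case: cov => _ [] _ _ [] /(_ e)[] _ + _ _.
by rewrite !inE => /orP[] /eqP; [left|right].
Qed.

Lemma loc_end (m : mark D) : loc (end_at A m) = None \/ loc (end_at A m) = Some (tag m).
Proof.
case: cov => _ [] _ _ [] _ /(_ m) + _.
by rewrite !inE => /orP[] /eqP; [left|right].
Qed.

Lemma cover_balanced v : balanced v.
Proof. by case: cov => _ [] _ _ _ []. Qed.

Lemma cover_RH_ge0 v : 0 <= RH_number v.
Proof. by case: cov => _ [] _ _ _ []. Qed.

Lemma cover_card_labels v : #|` labels v|%:Z = RH_number v.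
Proof. by case: cov => _ [] _ _ _ []. Qed.

Lemma cover_degree : (\sum_(v | @loc _ A v == None) local_degree v)%N = d.
Proof. by case: cov => _ [] _ _ _ []. Qed.

Lemma cover_curve : tropical_curve A.
Proof. by case: cov. Qed.

(** Conservation of the flow along ray [a], in a form valid at every vertex: over c the flow is
    created, on ray [a] it enters through edges, and on another ray both sides vanish. *)
Lemma flow_eq v a : outflow v a =
  (\sum_(e | (tgt e == v) && (loc (tgt e) == Some a)) weight e +
   (loc v == None) * local_degree v)%N.
Proof.
case lv: (loc v) => [b|] /=; last first.
  rewrite mul1n (balanced_center lv (@cover_balanced v)) big_pred0 ?add0n // => e.
  apply/negbTE/negP => /andP[/eqP tv _].
  by have := loc_tgt e; rewrite tv lv.
rewrite mul0n addn0; case: (eqVneq a b) => [->|ab].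
  rewrite (balanced_ray lv (@cover_balanced v)) /inflow; apply: eq_bigl => e.
  by case: eqP => //= ->; rewrite lv eqxx.
rewrite /outflow !big_pred0 // => [e|m|e]; apply/negbTE/negP => /andP[/eqP ev /eqP la].
- by move: ab; rewrite -ev la in lv; case: lv => ->; rewrite eqxx.
- by case: (loc_end m); rewrite ev lv // la => -[ba]; rewrite ba eqxx in ab.
- by case: (loc_src e); rewrite ev lv // la => -[ba]; rewrite ba eqxx in ab.
Qed.

Lemma center_exists : exists v, loc v = None.
Proof.
case: (pickP (fun v => loc v == None)) => [v /eqP|none]; first by exists v.
by have := cover_degree; rewrite big_pred0 // => dd; move: hd; rewrite -dd.
Qed.

(** Without an incoming edge, balancing makes the outflow 0, so no bounded edge starts at [v]
    either. Then [v] is isolated, although it must be connected to a vertex over c. *)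
Lemma tgt_edge_exists v : loc v != None -> exists e, tgt e = v.
Proof.
case lv: (loc v) => [a|] // _.
case: (pickP (fun e => tgt e == v)) => [e /eqP|none]; first by exists e.
have in0 : inflow v = 0%N by rewrite /inflow big_pred0.
have out0 : outflow v a = 0%N by rewrite (balanced_ray lv (@cover_balanced v)).
have nosrc e : src e != v.
  apply/eqP => ev; move: out0; rewrite /outflow (bigD1 e) /=.
    by move=> /eqP; rewrite -addnA addn_eq0 eqn0Ngt weight_gt0.
  rewrite ev eqxx /=; have := loc_tgt e.
  by case: (loc_src e) => [|<-]; rewrite ev lv ?eqxx.
have [[_ conn] _ _ _ _] := cover_curve.
have [u lu] := center_exists.
have /connectP[[|w s] /= pth ul] := conn v u; first by rewrite ul lv in lu.
case/andP: pth => /existsP[e /orP[] /andP[/eqP s1 /eqP s2]] _.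
  by have := nosrc e; rewrite s1 eqxx.
by have := none e; rewrite s2 eqxx.
Qed.

(* Induction along the edges directed away from c: it terminates because the
   position increases along edges. *)
Lemma center_ind_strong (P : 'I_(nvert A) -> Prop) :
  (forall v, loc v = None -> P v) ->
  (forall v, loc v != None -> (forall e, tgt e = v -> P (src e)) -> P v) ->
  forall v, P v.
Proof.
move=> P0 Pe v; apply: contrapT => nPv.
have bad : `[< ~ P v >] by apply/asboolP.
case: (@Order.TotalTheory.arg_minP _ R _ v (fun u => `[< ~ P u >]) p0 bad) => u /asboolP nPu umin.
have lu : loc u != None by apply/eqP => /P0.
apply: nPu; apply: Pe => // e eu.
apply: contrapT => nPs; move/asboolP: nPs => /umin.
by rewrite -eu => /(lt_le_trans (cover_pot_lt e)); rewrite ltxx.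
Qed.

Lemma center_ind (P : 'I_(nvert A) -> Prop) :
  (forall v, loc v = None -> P v) ->
  (forall e, P (src e) -> P (tgt e)) -> forall v, P v.
Proof.
move=> P0 Pe; apply: center_ind_strong => // v /tgt_edge_exists[e <-] H.
by apply: Pe; apply: H.
Qed.

(** Induction from the outermost vertices inwards: a counterexample of maximal position has no
    counterexample beyond it. *)
Lemma center_ind_dual (P : 'I_(nvert A) -> Prop) :
  (forall v, (forall e, src e = v -> P (tgt e)) -> P v) -> forall v, P v.
Proof.
move=> Pe v; apply: contrapT => nPv.
have bad : `[< ~ P v >] by apply/asboolP.
case: (@Order.TotalTheory.arg_maxP _ R _ v (fun u => `[< ~ P u >]) p0 bad) => u /asboolP nPu umax.
apply: nPu; apply: Pe => e eu.
apply: contrapT => nPs; move/asboolP: nPs => /umax.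
by rewrite -eu => /(lt_le_trans (cover_pot_lt e)); rewrite ltxx.
Qed.

Lemma valence_gt1 v : loc v != None -> (1 < valence v)%N.
Proof.
move=> lv; have [_ val1 _ _ _] := cover_curve.
have := val1 v; have [e ev] := tgt_edge_exists lv.
have : (0 < #|[pred e | tgt e == v]|)%N by apply/card_gt0P; exists e; rewrite inE ev.
rewrite /valence; lia.
Qed.

(** On a ray the RH-number is val + 2g - 2. The valence is at least 2, and if it is 2, the
    definition of a tropical curve gives g >= 1. *)
Lemma RH_gt0 v : loc v != None -> 0 < RH_number v.
Proof.
move=> lv; have := valence_gt1 lv; have [_ _ val2 _ _] := cover_curve.
have := val2 v; rewrite RH_split (negbTE lv); lia.
Qed.

(** No sign is imposed on the lengths: the condition is linear, so potentials can be combined, and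
    lengths 0 on the boundary of a cone are covered. *)
Definition potential (x : 'rV[R]_(nedge A)) (p : 'I_(nvert A) -> R) : Prop :=
  (forall e, p (tgt e) = p (src e) + (weight e)%:R * x 0 e) /\
  (forall v, loc v = None -> p v = 0).

Lemma cover_potential : potential x0 p0.
Proof. by split; [exact: cover_pot|move=> v /cover_pot_eq0]. Qed.

Lemma potential_unique x p p' : potential x p -> potential x p' -> p =1 p'.
Proof.
move=> [pe pc] [pe' pc']; apply: center_ind => [v lv|e IH]; first by rewrite pc ?pc'.
by rewrite pe pe' IH.
Qed.

Lemma potential_ge0 x p : potential x p -> (forall e, 0 <= x 0 e) -> forall v, 0 <= p v.
Proof.
move=> [pe pc] xge; apply: center_ind => [v lv|e IH]; first by rewrite pc.
by rewrite pe addr_ge0 // mulr_ge0.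
Qed.

End Cover.

(** * A basis of the cycles of the glued graph *)

Section CycleBasis.
Variables (R : realType) (D : profile) (d : nat) (A : ctype D).
Variables (x0 : 'rV[R]_(nedge A)) (p0 : 'I_(nvert A) -> R).
Hypotheses (hd : (0 < d)%N).
Hypothesis cov : is_cover d x0 p0.
Implicit Type v : 'I_(nvert A).
Implicit Type e : 'I_(nedge A).

Definition vertex_class v : 'rV[int]_(nvert A) :=
  if loc v is Some _ then delta_mx 0 v else 0.

(* The boundary map of the glued graph; the glued vertex over c is omitted, as
   the boundary of a chain has degree 0. *)
Definition boundary : 'M[int]_(nedge A, nvert A) :=
  \matrix_e (vertex_class (tgt e) - vertex_class (src e)).

Lemma vertex_classE v u : vertex_class v 0 u = ((loc v != None) && (v == u))%:R.
Proof.
rewrite /vertex_class; case: (loc v) => [a|] /=; rewrite mxE ?eqxx //=.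
by rewrite eq_sym.
Qed.

Lemma mul_boundaryE (z : 'rV[int]_(nedge A)) v : (z *m boundary) 0 v =
  if loc v is Some _ then \sum_(e | tgt e == v) z 0 e - \sum_(e | src e == v) z 0 e else 0.
Proof.
rewrite mxE; case lv: (loc v) => [a|]; last first.
  apply: big1 => e _; rewrite mxE.
  rewrite !mxE !vertex_classE.
  case: (eqVneq (tgt e) v) => [tv|_]; case: (eqVneq (src e) v) => [sv|_];
    rewrite ?andbF ?tv ?sv ?lv /= ?subrr ?mulr0 //.
rewrite [X in _ = X - _]big_mkcond [X in _ = _ - X]big_mkcond -sumrB; apply: eq_bigr => e _.
rewrite !mxE !vertex_classE (loc_tgt cov) /=.
have -> : (loc (src e) != None) && (src e == v) = (src e == v).
  by case: (eqVneq (src e) v) => [->|_]; rewrite ?lv ?andbF.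
by case: eqP => _; case: eqP => _; rewrite ?mulr1 ?mulr0 ?subr0 ?sub0r ?mulrN1 ?subrr ?mulr0.
Qed.

Lemma glue_center_eq v u a : loc v = Some a -> (glue_center u == Some v) = (u == v).
Proof.
move=> lv; rewrite /glue_center; case lu: (loc u) => [b|]; first by apply/eqP/eqP => [[]|->].
by case: (eqVneq u v) => // uv; rewrite uv lv in lu.
Qed.

(** The condition at the glued vertex follows from the others: summed over all vertices, inflow and
    outflow both give the sum of all coefficients of [z]. *)
Lemma is_cycleP (z : 'rV[int]_(nedge A)) : is_cycle z <-> z *m boundary = 0.
Proof.
split=> [cyc|zb p].
  apply/rowP => v; rewrite mul_boundaryE mxE; case lv: (loc v) => [a|] //.
  have := cyc (Some v); rewrite (eq_bigl (fun e => tgt e == v)) => [->|e].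
    rewrite (eq_bigl (fun e => src e == v)) => [|e]; first by rewrite subrr.
    exact: glue_center_eq lv.
  exact: glue_center_eq lv.
have inner v a : loc v = Some a ->
    \sum_(e | glue_center (tgt e) == Some v) z 0 e = \sum_(e | glue_center (src e) == Some v) z 0 e.
  move=> lv; have /rowP/(_ v) := zb; rewrite mul_boundaryE lv mxE => /subr0_eq.
  rewrite (eq_bigl (fun e => glue_center (tgt e) == Some v)) => [->|e].
    by apply: eq_bigl => e; rewrite (glue_center_eq _ lv).
  by rewrite (glue_center_eq _ lv).
have empty v (f : 'I_(nedge A) -> 'I_(nvert A)) : loc v = None ->
    \sum_(e | glue_center (f e) == Some v) z 0 e = 0.
  move=> lv; apply: big_pred0 => e; rewrite /glue_center.
  by case lf: (loc (f e)) => //; apply/eqP => -[fv]; rewrite fv lv in lf.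
case: p => [v|]; first by case lv: (loc v) => [a|]; [exact: inner lv|rewrite !empty].
have total (f : 'I_(nedge A) -> 'I_(nvert A)) : \sum_e z 0 e =
    \sum_(e | glue_center (f e) == None) z 0 e +
    \sum_(p | p != None) \sum_(e | glue_center (f e) == p) z 0 e.
  by rewrite (partition_big (fun e => glue_center (f e)) xpredT) // (bigD1 None).
have := total (@tgt _ A); rewrite (total (@src _ A)).
rewrite (eq_bigr (fun p => \sum_(e | glue_center (tgt e) == p) z 0 e)) => [/addIr->|[v|] //= _].
  by [].
by case lv: (loc v) => [a|]; [rewrite (inner _ _ lv)|rewrite !empty].
Qed.

(* The edges of a spanning tree of the glued graph: one incoming edge is
   selected at every vertex not over c. *)
Definition tree : {set 'I_(nedge A)} :=
  finset (fun e => [pick e' | tgt e' == tgt e] == Some e).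

Lemma tree_edge v : loc v != None -> exists2 e, e \in tree & tgt e = v.
Proof.
case/(tgt_edge_exists hd cov) => e ev.
have [f pf] : exists f, [pick e | tgt e == v] = Some f.
  by case: pickP => [f _|/(_ e)]; [exists f|rewrite ev eqxx].
have fv : tgt f = v by move: pf; case: pickP => // f' /eqP fv [<-].
by exists f => //; rewrite inE fv pf.
Qed.

Lemma tree_inj : {in tree &, injective (@tgt _ A)}.
Proof.
by move=> e f; rewrite !inE => /eqP He /eqP Hf ef; move: He; rewrite ef Hf => -[].
Qed.

Lemma card_tree : #|tree| = #|[pred v | @loc _ A v != None]|.
Proof.
rewrite -(card_in_imset tree_inj); apply: eq_card => v; rewrite inE.
apply/imsetP/idP => [[e _ ->]|/tree_edge[e et ev]]; first exact: loc_tgt cov e.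
by exists e.
Qed.

(** The glued vertex [None] exists because some vertex lies over c; it cancels the successor in
    [glued_b1]. The remaining vertices correspond to the tree edges. *)
Lemma glued_b1E : glued_b1 A = #|~: tree|.
Proof.
rewrite cardsCs finset.setCK card_ord card_tree /glued_b1.
have [c lc] := center_exists hd cov.
rewrite (cardD1 None) inE /=.
have -> : [exists v, @glue_center _ A v == None] by apply/existsP; exists c;
    rewrite /glue_center lc.
rewrite add1n subSS; congr (_ - _)%N.
rewrite -[RHS](card_imset _ (@Some_inj _)).
apply: eq_card => p; rewrite !inE; apply/andP/imsetP => [[pN /existsP[v /eqP vp]]|[v]].
  move: vp pN; rewrite /glue_center; case lv: (loc v) => [a|] <- // _.
  by exists v => //; rewrite inE lv.
rewrite inE => lv ->; split=> //; apply/existsP; exists v; rewrite /glue_center.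
by case: (loc v) lv.
Qed.

(** From the outside inwards: once the edges leaving [v] have coefficient 0, the only tree edge
    entering [v] carries the whole inflow, which must be 0. *)
Lemma tree_cycle0 (z : 'rV[int]_(nedge A)) : z *m boundary = 0 ->
  (forall e, e \notin tree -> z 0 e = 0) -> z = 0.
Proof.
move=> zb z0; apply/rowP => e; rewrite mxE; move: {2}(tgt e) (erefl (tgt e)) => v.
move: v e; apply: (center_ind_dual cov) => v IH e ev.
case: (boolP (e \in tree)) => [et|/z0//].
have /rowP/(_ v) := zb; rewrite mul_boundaryE mxE.
have := loc_tgt cov e; rewrite ev; case: (loc v) => // a _.
rewrite [X in _ - X]big1 ?subr0 => [|f /eqP fv]; last exact: IH fv _ erefl.
rewrite (bigD1 e) ?ev //= big1 ?addr0 // => f /andP[/eqP fv fe].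
by apply: z0; apply/negP => /tree_inj/(_ et); rewrite fv ev => /(_ erefl) /eqP; rewrite (negbTE fe).
Qed.

(** The chain is the tree path from the glued vertex to [v], built by adding the tree edge that
    enters [v]. *)
Lemma chain_exists v : exists T : 'rV[int]_(nedge A),
  T *m boundary = vertex_class v /\ forall e, e \notin tree -> T 0 e = 0.
Proof.
move: v; apply: (center_ind_strong cov) => [v lv|v lv IH].
  by exists 0; rewrite mul0mx /vertex_class lv; split=> // e; rewrite mxE.
have [e et ev] := tree_edge lv.
have [T [Tb T0]] := IH e ev.
exists (T + delta_mx 0 e); split.
  by rewrite mulmxDl Tb -rowE rowK ev addrC subrK.
move=> f ft; rewrite !mxE eqxx T0 // add0r.
by case: eqP => // fe; rewrite fe et in ft.
Qed.

Definition chain v : 'rV[int]_(nedge A) := sval (cid (chain_exists v)).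

Lemma chain_boundary v : chain v *m boundary = vertex_class v.
Proof. by have [] := svalP (cid (chain_exists v)). Qed.

Lemma chain_tree v e : e \notin tree -> chain v 0 e = 0.
Proof. by have [_] := svalP (cid (chain_exists v)); apply. Qed.

Definition fundamental_cycle e : 'rV[int]_(nedge A) :=
  delta_mx 0 e + chain (src e) - chain (tgt e).

Lemma fundamental_cycle_boundary e : fundamental_cycle e *m boundary = 0.
Proof.
rewrite /fundamental_cycle mulmxBl mulmxDl -rowE rowK !chain_boundary.
by rewrite subrK subrr.
Qed.

Lemma fundamental_cycleE e f : f \notin tree -> fundamental_cycle e 0 f = (f == e)%:R.
Proof. by move=> ft; rewrite !mxE !chain_tree // eqxx /= subr0 addr0. Qed.

(** On the non-tree edges the fundamental cycles form an identity matrix, so the coefficients of a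
    cycle are its values there. The difference to the resulting combination is a cycle supported on
    the tree, hence 0. *)
Lemma cycle_basis_exists : exists Z, @is_cycle_basis D A Z.
Proof.
pose t (j : 'I_(glued_b1 A)) : 'I_(nedge A) := enum_val (cast_ord glued_b1E j).
have tT j : t j \notin tree by rewrite -finset.in_setC; exact: enum_valP.
have t_inj : injective t by move=> i j /enum_val_inj /cast_ord_inj.
have t_surj e : e \notin tree -> exists j, t j = e.
  rewrite -finset.in_setC => et; exists (cast_ord (esym glued_b1E) (enum_rank_in et e)).
  by rewrite /t cast_ordKV enum_rankK_in.
pose Z : 'M[int]_(glued_b1 A, nedge A) := \matrix_j fundamental_cycle (t j).
have Zb : Z *m boundary = 0.
  by apply/row_matrixP => j; rewrite row_mul rowK row0 fundamental_cycle_boundary.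
have Zt (y : 'rV_(glued_b1 A)) i : (y *m Z) 0 (t i) = y 0 i.
  rewrite mxE (bigD1 i) //= mxE fundamental_cycleE // eqxx mulr1 big1 ?addr0 // => j ji.
  rewrite mxE fundamental_cycleE //; case: eqP => [/t_inj ij|]; last by rewrite mulr0.
  by rewrite ij eqxx in ji.
exists Z; split=> [j|z /is_cycleP zb].
  by apply/is_cycleP; rewrite rowK fundamental_cycle_boundary.
exists (\row_j z 0 (t j)); split=> [|y zy]; last first.
  by apply/rowP => j; rewrite mxE zy Zt.
apply/eqP; rewrite -subr_eq0; apply/eqP; apply: tree_cycle0.
  by rewrite mulmxBl zb -mulmxA Zb mulmx0 subrr.
by move=> e /t_surj[j <-]; rewrite mxE [X in _ + X]mxE Zt mxE subrr.
Qed.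

Lemma cycle_basisP : @is_cycle_basis D A (cycle_basis A).
Proof. exact: (@xgetPex _ 0 [set Z | @is_cycle_basis D A Z] cycle_basis_exists). Qed.

Lemma potential_boundary (x : 'rV[R]_(nedge A)) p : potential x p ->
  map_mx intr boundary *m (\col_v p v) = \col_e ((weight e)%:R * x 0 e).
Proof.
case=> pe pc; apply/colP => e; rewrite !mxE.
have vc v : \sum_j (vertex_class v 0 j)%:~R * p j = p v.
  rewrite (bigD1 v) //= vertex_classE eqxx andbT big1 => [|j jv]; last first.
    by rewrite vertex_classE [v == j]eq_sym (negbTE jv) andbF mul0r.
  by rewrite addr0; case lv: (loc v) => /=; rewrite ?mul1r // mul0r pc.
have -> : (weight e)%:R * x 0 e = p (tgt e) - p (src e) by rewrite pe addrC addKr.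
rewrite -!vc -sumrB; apply: eq_bigr => v _.
by rewrite !mxE rmorphB /= mulrBl.
Qed.

Lemma cycle_matrixE (x : 'rV[R]_(nedge A)) :
  map_mx intr (cycle_matrix A) *m x^T =
  map_mx intr (cycle_basis A) *m \col_e ((weight e)%:R * x 0 e).
Proof.
apply/colP => j; rewrite !mxE; apply: eq_bigr => e _.
by rewrite !mxE rmorphM /= mulrA.
Qed.

(** A vector of weighted lengths annihilates all cycles exactly when it is a coboundary. The
    potential at [v] is its integral along the tree path to [v]; the fundamental cycle of [e] gives
    the required increase along [e]. *)
Lemma closing_condition_potential (x : 'rV[R]_(nedge A)) :
  map_mx intr (cycle_matrix A) *m x^T = 0 :> 'cV[R]_(glued_b1 A) <->
  exists p, potential x p.
Proof.
have [cyc gen] := cycle_basisP.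
have Zb : cycle_basis A *m boundary = 0.
  by apply/row_matrixP => j; rewrite row_mul row0; apply/is_cycleP.
rewrite cycle_matrixE; split=> [Zx|[p /potential_boundary <-]]; last first.
  by rewrite mulmxA -map_mxM Zb map_mx0 mul0mx.
set wx := \col_e _ in Zx.
have cyc0 (z : 'rV[int]_(nedge A)) : z *m boundary = 0 -> map_mx intr z *m wx = 0.
  by move=> /is_cycleP/gen[y [-> _]]; rewrite map_mxM -mulmxA Zx mulmx0.
exists (fun v => (map_mx intr (chain v) *m wx) 0 0); split=> [e|v lv].
  have := cyc0 _ (fundamental_cycle_boundary e).
  rewrite /fundamental_cycle map_mxB map_mxD mulmxBl mulmxDl => /matrixP/(_ 0 0).
  rewrite mxE [X in X + _]mxE [X in _ + X]mxE [in RHS]mxE => /subr0_eq <-.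
  rewrite addrC; congr (_ + _).
  rewrite map_delta_mx -rowE !mxE //.
by rewrite cyc0 ?mxE // chain_boundary /vertex_class lv.
Qed.

End CycleBasis.

(** * Contractions *)

Lemma connect_rect_l (T : finType) (e : rel T) (x : T) (P : T -> Prop) :
  P x -> (forall y z, connect e x y -> P y -> e y z -> P z) -> forall y, connect e x y -> P y.
Proof.
move=> Px Pe y /connectP[s]; elim/last_ind: s y => [|s z IH] y /=; first by move=> _ ->.
rewrite rcons_path last_rcons => /andP[ps lz] ->.
apply: Pe lz; last exact: IH ps erefl.
by apply/connectP; exists s.
Qed.

Section Subgraphs.
Variables (D : profile) (A : ctype D) (Z : {set 'I_(nedge A)}).

Lemma adjZ_sym : connect_sym (@adjZ _ A Z).
Proof. by apply: sym_connect_sym => a b; apply: eq_existsb => e; rewrite orbC. Qed.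

Lemma adjZ_edge e : e \in Z -> adjZ Z (src e) (tgt e).
Proof. by move=> eZ; apply/existsP; exists e; rewrite eZ !eqxx. Qed.

Lemma adjZP (a b : 'I_(nvert A)) : adjZ Z a b ->
  exists2 e, e \in Z & (src e = a /\ tgt e = b) \/ (src e = b /\ tgt e = a).
Proof.
by case/existsP => e /andP[eZ /orP[] /andP[/eqP s /eqP t]]; exists e => //; [left|right].
Qed.

(* Starting from r, a vertex of the component is added together with an edge
   joining it to the previous ones. *)
Lemma card_component (r : 'I_(nvert A)) :
  (#|[pred v | connect (adjZ Z) r v]| <=
   #|[pred e in Z | connect (adjZ Z) r (src e)]|.+1)%N.
Proof.
pose E (S : {set 'I_(nvert A)}) := [pred e | [&& e \in Z, src e \in S & tgt e \in S]].
pose P (S : {set 'I_(nvert A)}) := [&& r \in S, S \subset connect (adjZ Z) r &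
    (#|S| <= #|E S|.+1)%N].
have P1 : P [set r]%SET.
  rewrite /P inE eqxx cards1 /= andbT; apply/fintype.subsetP => v; rewrite inE => /eqP->.
  exact: connect0.
case: (@arg_maxnP _ [set r]%SET P (fun S => #|S|) P1) => S /and3P[rS /fintype.subsetP Sr Sc] Smax.
have all v : connect (adjZ Z) r v -> v \in S.
  move: v; apply: connect_rect_l => // u w ru uS uw; apply/negPn/negP => wS.
  have [e eZ euw] := adjZP uw.
  suff : P (w |: S)%SET.
    by move/Smax; rewrite /= finset.cardsU1 wS add1n ltnn.
  apply/and3P; split.
  - by rewrite in_setU1 rS orbT.
  - apply/fintype.subsetP => v; rewrite in_setU1 => /orP[/eqP->|/Sr//].
    exact: connect_trans ru (connect1 uw).
  - rewrite finset.cardsU1 wS add1n ltnS; apply: leq_trans Sc _.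
    have eE : e \in E (w |: S)%SET.
      by rewrite inE eZ; case: euw => -[-> ->]; rewrite !in_setU1 !eqxx uS ?orbT.
    rewrite [X in (_ <= X)%N](cardD1 e) eE add1n ltnS; apply: subset_leq_card.
    apply/fintype.subsetP => f; rewrite !inE => /and3P[fZ fs ft].
    rewrite fZ fs ft !orbT !andbT; apply/eqP => fe.
    by move: fs ft wS; rewrite fe; case: euw => -[-> ->] => [_|] ->.
have -> : #|[pred v | connect (adjZ Z) r v]| = #|S|.
  by apply: eq_card => v; rewrite inE; apply/idP/idP => [/all|/Sr].
apply: leq_trans Sc _; rewrite ltnS; apply: subset_leq_card.
by apply/fintype.subsetP => e; rewrite !inE => /and3P[-> /Sr].
Qed.

End Subgraphs.

Section ConnectedTypes.
Variables (D : profile) (A : ctype D).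
Hypothesis cur : tropical_curve A.

(** This is [card_component] for the set of all edges; it makes the subtraction in [total_genus]
    exact. *)
Lemma leq_nvert_nedge : (nvert A <= (nedge A).+1)%N.
Proof.
have [[nv conn] _ _ _ _] := cur.
have c0 : 'I_(nvert A) := Ordinal nv.
have adjT : @adjZ _ A finset.setT =2 @adj _ A.
  by move=> a b; apply: eq_existsb => e; rewrite inE.
have := card_component finset.setT c0.
rewrite (eq_card (B := predT)) => [|v]; last by rewrite !inE (eq_connect adjT) conn.
rewrite card_ord => /leq_trans; apply; rewrite ltnS.
by apply: leq_trans (max_card _) _; rewrite card_ord.
Qed.

Lemma total_genusE : (total_genus A + nvert A = (nedge A).+1 + \sum_v @genus _ A v)%N.
Proof. by have := leq_nvert_nedge; rewrite /total_genus; lia. Qed.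

End ConnectedTypes.

(* q and h exhibit C as the contraction of the edges Z of A: q is the quotient
   map on vertices, h the inclusion of the remaining edges. The genus condition
   is g + #V = \sum g_V + #E + 1, without truncated subtraction. *)
Record is_contraction (D : profile) (A : ctype D) (Z : {set 'I_(nedge A)}) (C : ctype D)
    (q : 'I_(nvert A) -> 'I_(nvert C)) (h : 'I_(nedge C) -> 'I_(nedge A)) : Prop := {
  ctr_surj : forall c, exists v, q v = c;
  ctr_fiber : forall u v, q u = q v <-> connect (adjZ Z) u v;
  ctr_inj : injective h;
  ctr_edges : forall e, e \notin Z <-> exists f, h f = e;
  ctr_src : forall f, src f = q (src (h f));
  ctr_tgt : forall f, tgt f = q (tgt (h f));
  ctr_weight : forall f, weight f = weight (h f);
  ctr_end : forall m, end_at C m = q (end_at A m);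
  ctr_genus : forall c, (genus c + #|[pred v | q v == c]| =
    \sum_(v | q v == c) genus v + #|[pred e in Z | q (src e) == c]| + 1)%N;
  ctr_labels : forall c k, k \in labels c <-> exists2 v, q v = c & k \in labels v;
  ctr_loc : forall v, loc (q v) =
    if [exists u, (q u == q v) && (loc u == None)] then None else loc v }.

Section Contract.
Variables (R : realType) (D : profile) (d : nat) (A : ctype D).
Variables (x0 : 'rV[R]_(nedge A)) (p0 : 'I_(nvert A) -> R).
Hypothesis cov : is_cover d x0 p0.
Variable Z : {set 'I_(nedge A)}.

Lemma comp_of_eq (u v : 'I_(nvert A)) : comp_of Z u = comp_of Z v <-> connect (adjZ Z) u v.
Proof.
rewrite -(root_connect (@adjZ_sym _ A Z)) /=; split=> [uv|/eqP uv].
  have := congr1 (fun c => enum_val c) uv; rewrite /comp_of.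
  by rewrite !enum_rankK_in ?root_comp // => ->.
by apply: enum_val_inj; rewrite /comp_of !enum_rankK_in ?root_comp.
Qed.

(** An edge with no endpoint over c stays on one ray. So the ray that [contraction] reads off at the
    root of a component is that of all its vertices. *)
Lemma loc_component u v : connect (adjZ Z) u v ->
  (forall w, connect (adjZ Z) u w -> loc w != None) -> loc v = loc u.
Proof.
move=> uv nc; move: v uv; apply: connect_rect_l => // v w uv lv vw.
have uw : connect (adjZ Z) u w by exact: connect_trans uv (connect1 vw).
have [e eZ ee] := adjZP vw.
have := loc_src cov e; case: ee => -[-> ->].
  by case=> [lv0|<-//]; have := nc v uv; rewrite lv0.
by case=> [lw0|->//]; have := nc w uw; rewrite lw0.
Qed.

Lemma contraction_is_contraction :
  @is_contraction D A Z (contraction Z) (comp_of Z) enum_val.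
Proof.
have surj c : exists v, comp_of Z v = c.
  exists (enum_val c); apply: enum_val_inj; rewrite /comp_of enum_rankK_in ?root_comp //.
  by have := enum_valP c; rewrite inE => /eqP.
split=> //.
- exact: comp_of_eq.
- exact: enum_val_inj.
- move=> e; rewrite -finset.in_setC; split=> [eZ|[f <-]]; last exact: enum_valP.
  by exists (enum_rank_in eZ e); rewrite enum_rankK_in.
- move=> c /=; rewrite /comp_b1.
  (* [card_component], applied at a representative of [c], makes the subtraction in [comp_b1]
     exact. *)
  have [r rc] := surj c; have := card_component Z r.
  rewrite (eq_card (B := [pred v | comp_of Z v == c])); last first.
    by move=> v; rewrite !inE -rc eq_sym; apply/idP/eqP => /comp_of_eq.
  rewrite [X in (_ <= X.+1)%N -> _](eq_card (B := [pred e in Z | comp_of Z (src e) == c]));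
      last first.
    move=> e; rewrite !inE -rc; congr (_ && _); rewrite [RHS]eq_sym.
    by apply/idP/eqP => /comp_of_eq.
  set a := #|_|; set b := #|_|; move: (\sum_(_ | _) _)%N => s; lia.
- move=> c k /=; split.
    by case/bigfcupP => v; rewrite mem_index_enum /= => /eqP vc kv; exists v.
  by case=> v vc kv; apply/bigfcupP; exists v => //; rewrite mem_index_enum vc eqxx.
- move=> v /=; case: existsP => // nc.
  have ev : enum_val (comp_of Z v) = fingraph.root (adjZ Z) v.
    by rewrite /comp_of enum_rankK_in ?root_comp.
  rewrite ev; apply: loc_component; first exact: connect_root.
  move=> w vw; apply/eqP => lw; apply: nc; exists w; rewrite lw eqxx andbT.
  by apply/eqP/esym/comp_of_eq.
Qed.

End Contract.

(** * Contraction as a relation: isomorphisms, uniqueness, composition *)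

Section ContractionTheory.
Variable D : profile.
Implicit Types A C E : ctype D.

Lemma split_edges A Z C q h (ctr : @is_contraction D A Z C q h) (T : Type) (idx : T)
    (op : Monoid.com_law idx) (P : pred 'I_(nedge A)) (F : 'I_(nedge A) -> T) :
  \big[op/idx]_(e | P e) F e =
  op (\big[op/idx]_(e | (e \in Z) && P e) F e) (\big[op/idx]_(f | P (h f)) F (h f)).
Proof.
have inZ : \big[op/idx]_(e | P e && (e \in Z)) F e = \big[op/idx]_(e | (e \in Z) && P e) F e.
  by apply: eq_bigl => e; rewrite andbC.
have notZ : \big[op/idx]_(e | P e && (e \notin Z)) F e = \big[op/idx]_(f | P (h f)) F (h f).
  rewrite (eq_bigl (mem (h @: finset (fun f => P (h f))))); last first.
    move=> e /=; apply/andP/imsetP => [[Pe /(ctr_edges ctr)[f fe]]|[f]].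
      by exists f; rewrite // inE fe.
    by rewrite inE => Pf ->; split=> //; apply/(ctr_edges ctr); exists f.
  rewrite big_imset /=; first by apply: eq_bigl => f; rewrite inE.
  by move=> f f' _ _; apply: (ctr_inj ctr).
by rewrite -inZ -notZ (bigID (mem Z)).
Qed.

Lemma set0_connect A (u v : 'I_(nvert A)) : connect (adjZ finset.set0) u v <-> u = v.
Proof.
split=> [uv|->]; last exact: connect0.
move: v uv; apply: connect_rect_l => // v w _ _ /adjZP[e].
by rewrite inE.
Qed.

(** Transport along isomorphisms thereby becomes a case of [contraction_comp]. *)
Lemma iso_is_contraction A C f k k' : @is_type_iso D A C f k -> cancel k k' -> cancel k' k ->
  is_contraction finset.set0 f k'.
Proof.
move=> [[f' fK f'K] bk He Hm Hv] kK k'K.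
have finj := can_inj fK.
split=> //.
- by move=> c; exists (f' c).
- by move=> u v; split=> [/finj/set0_connect|/set0_connect->].
- exact: can_inj k'K.
- by move=> e; rewrite inE; split=> // _; exists (k e).
- by move=> e; have [<-] := He (k' e); rewrite k'K.
- by move=> e; have [_ <-] := He (k' e); rewrite k'K.
- by move=> e; have [_ _ <-] := He (k' e); rewrite k'K.
- move=> c; rewrite (eq_card (B := pred1 (f' c))); last first.
    by move=> v; rewrite !inE; apply/eqP/eqP => [<-|->].
  rewrite card1 (eq_bigl (pred1 (f' c))); last first.
    by move=> v /=; apply/eqP/eqP => [<-|->].
  rewrite big_pred1_eq (eq_card0 (A := [pred e in finset.set0 | f (src e) == c])); last first.
    by move=> e; rewrite !inE.
  by have [<- _ _] := Hv (f' c); rewrite f'K addn0.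
- move=> c l; split=> [lc|[v <-]]; last by have [_ -> _] := Hv v.
  by exists (f' c); rewrite ?f'K //; have [_ <- _] := Hv (f' c); rewrite f'K.
- move=> v; case: existsP => [[u /andP[/eqP/finj-> /eqP lv]]|_].
    by have [_ _ ->] := Hv v.
  by have [_ _ ->] := Hv v.
Qed.

Lemma contraction_is_iso A C q h : @is_contraction D A finset.set0 C q h ->
  exists k, [/\ is_type_iso q k, cancel k h & cancel h k].
Proof.
move=> ctr.
have qinj : injective q by move=> u v /(ctr_fiber ctr)/set0_connect.
have hs e : exists f, h f = e by apply/(ctr_edges ctr); rewrite inE.
have /choice[k kK] := hs.
have hK : cancel h k by move=> f; apply: (ctr_inj ctr); rewrite kK.
have /choice[q' q'K] := ctr_surj ctr.
have qK : cancel q q' by move=> v; apply: qinj; rewrite q'K.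
have card1q v : #|[pred u | q u == q v]| = 1%N.
  by rewrite -(card1 v); apply: eq_card => u; rewrite !inE; apply/eqP/eqP => [/qinj|->].
exists k; split=> //; split=> [||e|m|v].
- by exists q'.
- by exists h.
- by rewrite (ctr_src ctr) (ctr_tgt ctr) (ctr_weight ctr) kK.
- exact: ctr_end ctr m.
split.
- have := ctr_genus ctr (q v); rewrite card1q.
  rewrite (eq_bigl (pred1 v)); last by move=> u /=; apply/eqP/eqP => [/qinj|->].
  rewrite big_pred1_eq (eq_card0 (A := [pred e in finset.set0 | q (src e) == q v])); last first.
    by move=> e; rewrite !inE.
  by rewrite addn0 => /addIn.
- apply/fsetP => l; apply/idP/idP => [/(ctr_labels ctr)[u /qinj->//]|lv].
  by apply/(ctr_labels ctr); exists v.
rewrite (ctr_loc ctr); case: existsP => // -[u /andP[/eqP/qinj-> /eqP ->]] //.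
Qed.

(** The fields of [is_contraction] determine all data of the target from [A] and [Z], up to
    renaming. The isomorphism on vertices is [q'] after a section of [q]. *)
Lemma contraction_unique A Z C q h C' q' h' :
  @is_contraction D A Z C q h -> @is_contraction D A Z C' q' h' ->
  exists f k, [/\ @is_type_iso D C C' f k, forall v, f (q v) = q' v & forall e, h' (k e) = h e].
Proof.
move=> ctr ctr'.
have /choice[s sK] := ctr_surj ctr; have /choice[s' s'K] := ctr_surj ctr'.
have qq' u v : q u = q v <-> q' u = q' v.
  by rewrite (ctr_fiber ctr) (ctr_fiber ctr').
have ek e : exists e', h' e' = h e.
  by apply/(ctr_edges ctr'); apply/(ctr_edges ctr); exists e.
have ek' e' : exists e, h e = h' e'.
  by apply/(ctr_edges ctr); apply/(ctr_edges ctr'); exists e'.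
have /choice[k kE] := ek; have /choice[k' k'E] := ek'.
pose f c := q' (s c).
have fq v : f (q v) = q' v by apply/qq'; rewrite sK.
have qb v u : (q v == q u) = (q' v == q' u) by apply/eqP/eqP => /qq'.
exists f, k; split=> //; split.
- exists (fun c => q (s' c)) => c; first by rewrite -[RHS]sK; apply/qq'; rewrite s'K.
  by rewrite fq s'K.
- exists k' => e; first by apply: (ctr_inj ctr); rewrite k'E kE.
  by apply: (ctr_inj ctr'); rewrite kE k'E.
- move=> e; rewrite (ctr_src ctr) (ctr_tgt ctr) (ctr_weight ctr) !fq.
  by rewrite (ctr_src ctr') (ctr_tgt ctr') (ctr_weight ctr') kE.
- by move=> m; rewrite (ctr_end ctr) (ctr_end ctr') fq.
move=> c; have [v <-] := ctr_surj ctr c; rewrite fq; split.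
- have := ctr_genus ctr (q v); have := ctr_genus ctr' (q' v).
  rewrite (eq_card (B := [pred u | q u == q v])); last by move=> u; rewrite !inE qb.
  rewrite [X in (X + _ + 1)%N](eq_bigl (fun u => q u == q v)); last by move=> u; rewrite qb.
  rewrite [X in (_ + X + 1)%N](eq_card (B := [pred e in Z | q (src e) == q v])).
    by move=> <- /addIn.
  by move=> e; rewrite !inE qb.
- apply/fsetP => l; apply/idP/idP.
    case/(ctr_labels ctr') => u /qq' uv lu.
    by apply/(ctr_labels ctr); exists u.
  case/(ctr_labels ctr) => u /qq' uv lu.
  by apply/(ctr_labels ctr'); exists u.
rewrite (ctr_loc ctr) (ctr_loc ctr').
by under eq_existsb => u do rewrite -qb.
Qed.

Lemma contraction_comp A Z C q h Y E q' h' :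
  @is_contraction D A Z C q h -> @is_contraction D C Y E q' h' ->
  is_contraction (Z :|: h @: Y)%SET (q' \o q) (h \o h').
Proof.
move=> ctr ctr'.
have hY f : (h f \in h @: Y) = (f \in Y) by rewrite mem_imset //; exact: ctr_inj ctr.
have hZ f : h f \notin Z by apply/(ctr_edges ctr); exists f.
have fiber u v : q' (q u) = q' (q v) <-> connect (adjZ (Z :|: h @: Y)%SET) u v.
  split.
    move/(ctr_fiber ctr') => uv.
    (* A [Y]-path in [C] lifts edge by edge to [A]; consecutive lifted edges are joined by [Z]-paths
       inside the fibres of [q]. *)
    suff H c : connect (adjZ Y) (q u) c ->
        forall w, q w = c -> connect (adjZ (Z :|: h @: Y)%SET) u w by exact: H uv _ _.
    have sub a b : q a = q b -> connect (adjZ (Z :|: h @: Y)%SET) a b.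
      move/(ctr_fiber ctr); apply: connect_sub => {}a {}b /adjZP[e eZ ee].
      apply: connect1; apply/existsP; exists e; rewrite finset.in_setU eZ /=.
      by case: ee => -[-> ->]; rewrite !eqxx ?orbT.
    move: c; apply: connect_rect_l => [w uw|b c _ IH /adjZP[f fY ee] w wc].
      by apply: sub; rewrite uw.
    have [e1 e2] : exists2 a, q a = b & exists2 a', q a' = c & adjZ (Z :|: h @: Y)%SET a a'.
      case: ee => -[sb tc].
        exists (src (h f)); first by rewrite -sb (ctr_src ctr).
        exists (tgt (h f)); first by rewrite -tc (ctr_tgt ctr).
        by apply: adjZ_edge; rewrite finset.in_setU hY fY orbT.
      exists (tgt (h f)); first by rewrite -tc (ctr_tgt ctr).
      exists (src (h f)); first by rewrite -sb (ctr_src ctr).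
      apply/existsP; exists (h f); rewrite finset.in_setU hY fY orbT /=.
      by rewrite !eqxx orbT.
    case=> [a' a'c aa'].
    apply: connect_trans (IH _ e2) _; apply: connect_trans (connect1 aa') _.
    by apply: sub; rewrite a'c.
  move: v; apply: connect_rect_l => // v w _ -> /adjZP[e].
  rewrite finset.in_setU => /orP[eZ ee|/imsetP[f fY ->] ee].
    congr q'; apply/(ctr_fiber ctr); apply: connect1; apply/existsP; exists e.
    by rewrite eZ; case: ee => -[-> ->]; rewrite !eqxx ?orbT.
  apply/(ctr_fiber ctr'); apply: connect1; apply/existsP; exists f.
  by rewrite fY (ctr_src ctr) (ctr_tgt ctr); case: ee => -[-> ->]; rewrite !eqxx ?orbT.
split=> //.
- by move=> c; have [b <-] := ctr_surj ctr' c; have [v <-] := ctr_surj ctr b; exists v.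
- by apply: inj_comp; [exact: ctr_inj ctr|exact: ctr_inj ctr'].
- move=> e; rewrite finset.in_setU negb_or; split.
    case/andP => /(ctr_edges ctr)[f <-]; rewrite hY => /(ctr_edges ctr')[f' <-].
    by exists f'.
  case=> f <- /=; rewrite hZ hY; apply/(ctr_edges ctr'); by exists f.
- by move=> f /=; rewrite (ctr_src ctr') (ctr_src ctr).
- by move=> f /=; rewrite (ctr_tgt ctr') (ctr_tgt ctr).
- by move=> f /=; rewrite (ctr_weight ctr') (ctr_weight ctr).
- by move=> f /=; rewrite (ctr_end ctr') (ctr_end ctr).
- move=> c /=.
  (* The genus conditions of the first contraction are summed over the fibre of [q']. Combined with
     the condition of the second one, the genera and the number of intermediate vertices cancel. *)
  have sum1 : (\sum_(b | q' b == c) (genus b + #|[pred v | q v == b]|) =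
      \sum_(b | q' b == c) (\sum_(v | q v == b) genus v + #|[pred e in Z | q (src e) == b]| + 1))%N.
    by apply: eq_bigr => b _; exact: ctr_genus ctr b.
  have cardY : #|[pred e in (Z :|: h @: Y)%SET | q' (q (src e)) == c]| =
      (#|[pred e in Z | q' (q (src e)) == c]| + #|[pred f in Y | q' (src f) == c]|)%N.
    rewrite -!sum1_card (split_edges ctr); congr addn.
      by apply: eq_bigl => e; rewrite !inE; case: (e \in Z).
    by apply: eq_bigl => f; rewrite !inE hY (negbTE (hZ f)) (ctr_src ctr).
  move: sum1; rewrite !big_split /= sum1_card (card_fiberT q) (big_fiberT _ q (fun b => q' b == c)).
  have -> : (\sum_(b | q' b == c) #|[pred e in Z | q (src e) == b]| =
      #|[pred e in Z | q' (q (src e)) == c]|)%N.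
    have := card_fiber (fun e => q (src e)) (fun b => q' b == c) (mem Z).
    rewrite (eq_card (B := [pred e in Z | q' (q (src e)) == c])); last first.
      by move=> e; rewrite !inE andbC.
    move=> <-; apply: eq_bigr => b _; apply: eq_card => e; by rewrite !inE andbC.
  rewrite cardY; have := ctr_genus ctr' c.
  set a := (\sum_(_ | _) _)%N; set b := (\sum_(_ | _) _)%N.
  set k1 := #|_|; set k2 := #|_|; set k3 := #|_|; set k4 := #|_|.
  lia.
- move=> c k /=; split.
    case/(ctr_labels ctr') => b bc /(ctr_labels ctr)[v vb lv].
    by exists v; rewrite ?vb.
  case=> v vc lv; apply/(ctr_labels ctr'); exists (q v) => //.
  by apply/(ctr_labels ctr); exists v.
move=> v /=; rewrite (ctr_loc ctr') (ctr_loc ctr).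
case: existsP => [[b /andP[/eqP bv]]|nb].
  have [w wb] := ctr_surj ctr b; rewrite -wb (ctr_loc ctr) => lb.
  case: existsP => // -[]; move: lb; case: existsP => [[u /andP[/eqP uw lu]] _|_ lw].
    by exists u; rewrite uw wb bv eqxx.
  by exists w; rewrite wb bv eqxx.
case: existsP => [[u /andP[/eqP uv lu]]|nu].
  by case: existsP => // -[]; exists u; rewrite uv eqxx.
case: existsP => // -[u /andP[/eqP uv lu]]; case: nb; exists (q u).
by rewrite uv eqxx (ctr_loc ctr); case: existsP.
Qed.

End ContractionTheory.

(** * Covers are preserved by contractions *)

Lemma card_bigfcup_disjoint (I : eqType) (K : choiceType) (s : seq I) (P : pred I)
    (F : I -> {fset K}) : uniq s ->
  (forall i j, i != j -> [disjoint F i & F j]%fset) ->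
  (#|` (\bigcup_(i <- s | P i) F i)%fset| = \sum_(i <- s | P i) #|` F i|)%N.
Proof.
move=> + dis; elim: s => [|i s IH] /=; first by rewrite !big_nil cardfs0.
case/andP => is_ us; rewrite !big_cons; case: (P i); last exact: IH.
rewrite cardfsU IH // (_ : (F i `&` _)%fset = fset0) ?cardfs0 ?subn0 //.
apply/fsetP => k; rewrite in_fsetI in_fset0; apply/negP => /andP[ki /bigfcupP[j /andP[js _] kj]].
have /dis/fdisjointP/(_ k ki) : i != j by apply: contra is_ => /eqP->.
by rewrite kj.
Qed.

(** * Restrictions on the valence imposed by balancing *)

Section BalancedValence.
Variables (D : profile) (A : ctype D) (v : 'I_(nvert A)).
Hypotheses (w_gt0 : forall e, (0 < @weight _ A e)%N) (part_gt0 : forall m : mark D, (0 < part m)%N).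
Hypothesis loc_edge : forall e, loc (tgt e) != None /\ @loc _ A (src e) \in [:: None; loc (tgt e)].
Hypothesis loc_ends : forall m, loc (end_at A m) \in [:: None; Some (tag m)].
Hypothesis bal : balanced v.

Definition outcount (a : 'I_3) : nat :=
  (#|[pred e | (src e == v) && (loc (tgt e) == Some a)]| +
   #|[pred m | (end_at A m == v) && (tag m == a)]|)%N.

Lemma outcount_gt0 a : (0 < outcount a)%N = (0 < outflow v a)%N.
Proof.
rewrite /outcount /outflow !addn_gt0; congr (_ || _); apply/idP/idP.
- by case/card_gt0P => e ve; rewrite (bigD1 e) //= addn_gt0 w_gt0.
- by apply: contraTT; rewrite -!eqn0Ngt => /eqP/card0_eq ve; rewrite big_pred0.
- by case/card_gt0P => e ve; rewrite (bigD1 e) //= addn_gt0 part_gt0.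
- by apply: contraTT; rewrite -!eqn0Ngt => /eqP/card0_eq ve; rewrite big_pred0.
Qed.

Lemma incount_gt0 : (0 < #|[pred e | tgt e == v]|)%N = (0 < inflow v)%N.
Proof.
apply/idP/idP.
  by case/card_gt0P => e ve; rewrite /inflow (bigD1 e) //= addn_gt0 w_gt0.
by apply: contraTT; rewrite -!eqn0Ngt => /eqP/card0_eq ve; rewrite /inflow big_pred0.
Qed.

Lemma valence_outcount : valence v = (\sum_a outcount a + #|[pred e | tgt e == v]|)%N.
Proof.
rewrite /valence big_split /= -addnA [X in (_ + X)%N]addnC addnA; congr (_ + _ + _)%N.
  rewrite -sum1_card.
  rewrite (partition_big (fun e => odflt ord0 (loc (tgt e))) xpredT) //=.
  apply: eq_bigr => a _; rewrite -sum1_card; apply: eq_bigl => e; rewrite !inE.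
  by have [] := loc_edge e; case: (loc (tgt e)).
rewrite -sum1_card (partition_big (fun m : mark D => tag m) xpredT) //=.
by apply: eq_bigr => a _; rewrite -sum1_card.
Qed.

(** A direction carries flow exactly when it contains an edge, so by balancing either all directions
    at [v] contain edges or none does. There are two directions on a ray and three at c. *)
Lemma balanced_valence : valence v != 1%N /\ (loc v = None -> valence v != 2%N).
Proof.
rewrite valence_outcount; case lv: (loc v) => [a|].
  split=> //; rewrite (bigD1 a) //= big1 ?addn0 => [|b ba].
    have := outcount_gt0 a; have := incount_gt0; rewrite (balanced_ray lv bal).
    by move: (outcount a) #|_|; lia.
  apply/eqP; rewrite eqn0Ngt outcount_gt0 /outflow !big_pred0 // => [m|e].
    apply/negbTE/negP => /andP[/eqP em /eqP tm].
    by have := loc_ends m; rewrite em lv tm !inE /= => /eqP[ab]; rewrite ab eqxx in ba.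
  apply/negbTE/negP => /andP[/eqP em /eqP tm].
  by have [_] := loc_edge e; rewrite em lv tm !inE /= => /eqP[ab]; rewrite ab eqxx in ba.
rewrite (eq_card0 (A := [pred e | tgt e == v])) => [|e]; last first.
  by rewrite !inE; apply/eqP => ev; have [] := loc_edge e; rewrite ev lv.
have cnt a : (0 < outcount a)%N = (0 < local_degree v)%N.
  by rewrite outcount_gt0 balanced_center.
rewrite !big_ord_recl big_ord0.
by split=> [|_]; move: (cnt ord0) (cnt (lift ord0 ord0)) (cnt (lift ord0 (lift ord0 ord0))); lia.
Qed.

End BalancedValence.

(** * A contraction of a cover is again a cover *)

Section Transfer.
Variables (R : realType) (D : profile) (d : nat) (A : ctype D).
Variables (x0 : 'rV[R]_(nedge A)) (p0 : 'I_(nvert A) -> R).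
Hypotheses (hd : (0 < d)%N) (hD : forall a, partition_of d (D a)).
Hypothesis cov : is_cover d x0 p0.
Variables (x : 'rV[R]_(nedge A)) (p : 'I_(nvert A) -> R).
Hypotheses (pot : potential x p) (x_ge0 : forall e, 0 <= x 0 e).
Variables (C : ctype D) (q : 'I_(nvert A) -> 'I_(nvert C)) (h : 'I_(nedge C) -> 'I_(nedge A)).
Local Notation Z := (zero_edges x).
Hypothesis ctr : is_contraction Z q h.

Lemma in_zero_edges e : (e \in Z) = (x 0 e == 0).
Proof. by rewrite inE. Qed.

Lemma remaining_gt0 f : 0 < x 0 (h f).
Proof.
rewrite lt_def x_ge0 andbT -in_zero_edges.
by apply/(ctr_edges ctr); exists f.
Qed.

Lemma fiber_pot u v : q u = q v -> p u = p v.
Proof.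
move/(ctr_fiber ctr); move: v; apply: connect_rect_l => // v w _ -> /adjZP[e].
rewrite in_zero_edges => /eqP xe; have := (proj1 pot) e.
by rewrite xe mulr0 addr0; case=> ee; case=> -[<- <-].
Qed.

(** Positions agree on fibres and weights are positive, so an edge inside a fibre has length 0. In
    particular no remaining edge becomes a loop. *)
Lemma contracted_edge e : (e \in Z) = (q (src e) == q (tgt e)).
Proof.
apply/idP/eqP => [eZ|/fiber_pot pe].
  by apply/(ctr_fiber ctr); apply: connect1; apply: adjZ_edge.
have := (proj1 pot) e; rewrite -pe -[X in X = _ -> _]addr0 => /addrI/esym/eqP.
by rewrite mulf_eq0 pnatr_eq0 eqn0Ngt (weight_gt0 cov) in_zero_edges.
Qed.

(** If the position at the end of an edge is 0, then so are its length and the position at its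
    start. Hence a vertex at position 0 is joined to one over c by contracted edges. *)
Lemma pot_eq0_center v : p v = 0 <-> loc (q v) = None.
Proof.
split=> [|lv]; last first.
  move: lv; rewrite (ctr_loc ctr); case: existsP => [[u /andP[/eqP uv /eqP lu]] _|_ lv].
    by rewrite -(fiber_pot uv) (proj2 pot).
  exact: (proj2 pot).
move: v; apply: (center_ind hd cov) => [v lv _|e IH].
  by rewrite (ctr_loc ctr) lv; case: existsP.
have pge := potential_ge0 hd cov pot x_ge0.
rewrite (proj1 pot) => /eqP; rewrite paddr_eq0 ?mulr_ge0 // => /andP[/eqP/IH ps].
rewrite mulf_eq0 pnatr_eq0 eqn0Ngt (weight_gt0 cov) /= -in_zero_edges contracted_edge.
by move=> /eqP <-.
Qed.

Lemma loc_remaining_tgt f : loc (tgt f) = loc (tgt (h f)) /\ loc (tgt f) != None.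
Proof.
have tN : loc (tgt f) != None.
  apply/eqP; rewrite (ctr_tgt ctr) => /pot_eq0_center pt.
  have := remaining_gt0 f; have pge := potential_ge0 hd cov pot x_ge0 (src (h f)).
  have := (proj1 pot) (h f); rewrite pt => /eqP.
  rewrite eq_sym paddr_eq0 ?mulr_ge0 // => /andP[_].
  rewrite mulf_eq0 pnatr_eq0 eqn0Ngt (weight_gt0 cov) /= => /eqP->.
  by rewrite ltxx.
split=> //; move: tN; rewrite (ctr_tgt ctr) (ctr_loc ctr).
by case: ifP.
Qed.

Definition fiber_degree c := (\sum_(v | q v == c) (loc v == None) * local_degree v)%N.

(** Sum [flow_eq] over the fibre of [c]. A contracted edge has both endpoints in the same fibre, so
    it contributes equally to both sides and cancels. *)
Lemma outflow_contraction c a : outflow c a =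
  (\sum_(f | (tgt f == c) && (loc (tgt f) == Some a)) weight f + fiber_degree c)%N.
Proof.
have flow : (\sum_(v | q v == c) outflow v a =
   \sum_(v | q v == c) (\sum_(e | (tgt e == v) && (loc (tgt e) == Some a)) weight e +
   (loc v == None) * local_degree v))%N.
  by apply: eq_bigr => v _; exact: flow_eq cov v a.
move: flow; rewrite !big_split /=.
rewrite (big_fiber _ (@src _ A) (fun v => q v == c)).
rewrite (big_fiber _ (@tgt _ A) (fun v => q v == c)).
rewrite (big_fiber _ (@end_at _ A) (fun v => q v == c)).
rewrite (split_edges ctr) [in RHS](split_edges ctr) -/(fiber_degree c) /=.
rewrite (eq_bigl (fun e => (e \in Z) && ((q (src e) == c) && (loc (tgt e) == Some a)))) => [|e];
    last first.
  by case eZ: (e \in Z) => //=; move: eZ; rewrite contracted_edge => /eqP->.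
rewrite [X in _ = (X + _ + _)%N](eq_bigl (fun e =>
    (e \in Z) && ((q (src e) == c) && (loc (tgt e) == Some a)))) => [|e]; last first.
  by case eZ: (e \in Z) => //=; move: eZ; rewrite contracted_edge => /eqP->.
rewrite -!addnA => /addnI; rewrite /outflow => flow.
have -> : (\sum_(f | (tgt f == c) && (loc (tgt f) == Some a)) weight f =
    \sum_(f | (q (tgt (h f)) == c) && (loc (tgt (h f)) == Some a)) weight (h f))%N.
  by apply: eq_big => [f|f _];
      rewrite ?(ctr_weight ctr) // (proj1 (loc_remaining_tgt f)) (ctr_tgt ctr).
rewrite -flow; congr (_ + _)%N.
  by apply: eq_big => [f|f _];
      rewrite ?(ctr_weight ctr) // (proj1 (loc_remaining_tgt f)) (ctr_src ctr).
by apply: eq_bigl => m; rewrite (ctr_end ctr).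
Qed.

Lemma center_fiber_degree c : loc c = None -> forall a, outflow c a = fiber_degree c.
Proof.
move=> lc a; rewrite outflow_contraction big_pred0 // => f.
by apply/negbTE/negP => /andP[/eqP fc _]; have := proj2 (loc_remaining_tgt f); rewrite fc lc.
Qed.

Lemma fiber_degree_ray c : loc c != None -> fiber_degree c = 0%N.
Proof.
have [v <-] := ctr_surj ctr c; rewrite (ctr_loc ctr); case: existsP => // nu _.
apply: big1 => u uv; case: eqP => [lu|]; last by rewrite mul0n.
by case: nu; exists u; rewrite uv lu.
Qed.

Lemma local_degree_contraction c : ((loc c == None) * local_degree c = fiber_degree c)%N.
Proof.
case: (eqVneq (loc c) None) => [lc|/fiber_degree_ray->]; last by rewrite mul0n.
by rewrite mul1n local_degreeE center_fiber_degree.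
Qed.

Lemma card_split_edges (P : pred 'I_(nedge A)) :
  (#|[pred e | P e]| = #|[pred e in Z | P e]| + #|[pred f | P (h f)]|)%N.
Proof. by rewrite -!sum1_card (split_edges ctr). Qed.

Lemma valence_contraction c :
  (\sum_(v | q v == c) valence v = valence c + 2 * #|[pred e in Z | q (src e) == c]|)%N.
Proof.
rewrite /valence !big_split /= !card_fiberT (card_split_edges (fun e => q (src e) == c)).
rewrite (card_split_edges (fun e => q (tgt e) == c)).
rewrite (eq_card (B := [pred e in Z | q (src e) == c]) (A := [pred e in Z | q (tgt e) == c]));
    last first.
  by move=> e; rewrite !inE; case: (boolP (x 0 e == 0)) => //=;
      rewrite -in_zero_edges contracted_edge => /eqP->.
rewrite (eq_card (B := [pred f | src f == c]) (A := [pred f | q (src (h f)) == c])); last first.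
  by move=> f; rewrite !inE (ctr_src ctr).
rewrite (eq_card (B := [pred f | tgt f == c]) (A := [pred f | q (tgt (h f)) == c])); last first.
  by move=> f; rewrite !inE (ctr_tgt ctr).
rewrite (eq_card (B := [pred m | end_at C m == c]) (A := [pred m | q (end_at A m) == c]));
    last first.
  by move=> m; rewrite !inE (ctr_end ctr).
by move: #|_| #|_| #|_| #|_|; lia.
Qed.

(** Contracting a connected graph with k vertices and m edges removes 2m from the sum of valences,
    adds 2(m - k + 1) to twice the genus, and replaces k terms -2 by one. These changes cancel, and
    local degrees over c add up. *)
Lemma RH_contraction c : RH_number c = \sum_(v | q v == c) RH_number v.
Proof.
rewrite RH_split local_degree_contraction.
under eq_bigr => v _ do rewrite RH_split.
rewrite !sumrB /=.
have sumz (F : 'I_(nvert A) -> nat) :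
    \sum_(v | q v == c) (F v)%:Z =
        (\sum_(v | q v == c) F v)%N%:Z by rewrite (big_morph Posz PoszD (erefl 0%:Z)).
rewrite !sumz -/(fiber_degree c); congr (_ - _).
rewrite sum_nat_const big_split /= valence_contraction -big_distrr /=.
have := ctr_genus ctr c.
by move: #|_| #|_| (\sum_(_ | _) _)%N; lia.
Qed.

Lemma labels_disjoint u v k : k \in @labels _ A u -> k \in @labels _ A v -> u = v.
Proof.
have [_ _ _ dis _] := cover_curve cov; move=> ku kv.
apply/eqP/negPn/negP => /dis /fdisjointP /(_ k ku); by rewrite kv.
Qed.

Lemma card_labels_contraction (c : 'I_(nvert C)) : #|` labels c|%:Z = RH_number c.
Proof.
rewrite RH_contraction.
have -> : labels c = (\bigcup_(v | q v == c) labels v)%fset.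
  apply/fsetP => k; apply/idP/bigfcupP => [/(ctr_labels ctr)[v vc kv]|[v /andP[_ /eqP vc] kv]].
    by exists v; rewrite // mem_index_enum vc eqxx.
  by apply/(ctr_labels ctr); exists v.
rewrite card_bigfcup_disjoint ?index_enum_uniq // => [|u v uv].
  rewrite (big_morph Posz PoszD (erefl 0%:Z)); apply: eq_bigr => v _;
      exact: cover_card_labels cov v.
by have [_ _ _ dis _] := cover_curve cov; exact: dis.
Qed.

Lemma loc_edge_contraction f :
  loc (tgt f) != None /\ @loc _ C (src f) \in [:: None; loc (tgt f)].
Proof.
have [tf tN] := loc_remaining_tgt f; split=> //; rewrite tf (ctr_src ctr) (ctr_loc ctr).
case: ifP => _ //.
by rewrite !inE; case: (loc_src cov (h f)) => ->; rewrite eqxx ?orbT.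
Qed.

Lemma loc_end_contraction m : loc (end_at C m) \in [:: None; Some (tag m)].
Proof.
rewrite (ctr_end ctr) (ctr_loc ctr); case: ifP => // _.
by rewrite !inE; case: (loc_end cov m) => ->; rewrite eqxx ?orbT.
Qed.

Lemma balanced_contraction (c : 'I_(nvert C)) : balanced c.
Proof.
case lc: (loc c) => [a|] delta delta'; rewrite lc /=.
  rewrite !inE => dd dd'.
  have oi : outflow c a = inflow c.
    rewrite outflow_contraction fiber_degree_ray ?lc // addn0 /inflow.
    by apply: eq_bigl => f; case: eqP => //= ->; rewrite lc eqxx.
  by case/orP: dd => /eqP->; case/orP: dd' => /eqP->; rewrite ?sumn_inflow ?sumn_outflow ?oi.
move=> /mapP[a _ ->] /mapP[b _ ->].
by rewrite !sumn_outflow !center_fiber_degree.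
Qed.

Lemma tropical_curve_contraction : tropical_curve C.
Proof.
have [[nv conn] _ _ _ [r rE]] := cover_curve cov.
have wC f : (0 < @weight _ C f)%N by rewrite (ctr_weight ctr) (weight_gt0 cov).
have adjq u v : adj u v -> connect (@adj _ C) (q u) (q v).
  case/existsP => e ee; case: (boolP (e \in Z)) => [|/(ctr_edges ctr)[f fe]].
    rewrite contracted_edge => /eqP qe; apply: eq_connect0.
    by case/orP: ee => /andP[/eqP <- /eqP <-].
  apply: connect1; apply/existsP; exists f; rewrite (ctr_src ctr) (ctr_tgt ctr) fe.
  by case/orP: ee => /andP[/eqP -> /eqP ->]; rewrite !eqxx ?orbT.
have val c := balanced_valence wC (part_gt0 hD) loc_edge_contraction
  loc_end_contraction (@balanced_contraction c).
split=> //.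
- split.
    by apply: leq_ltn_trans (ltn_ord (q (Ordinal nv))).
  move=> a b; have [u <-] := ctr_surj ctr a; have [v <-] := ctr_surj ctr b.
  move: (conn u v); move: v; apply: connect_rect_l => // v w _ uv vw.
  exact: connect_trans uv (adjq _ _ vw).
- by move=> c; have [] := val c.
(* A vertex of valence 2 lies on a ray, and with genus 0 its RH-number would be 0. But it is a sum
   of nonnegative RH-numbers of vertices off c, one of which is positive. *)
- move=> c vc; rewrite lt0n; apply/eqP => gc.
  case lc: (loc c) => [a|]; last by have [_ /(_ lc)] := val c; rewrite vc.
  have := RH_ray lc; rewrite vc gc RH_contraction => /eqP; rewrite subrr.
  have [v vc'] := ctr_surj ctr c; rewrite (bigD1 v) ?vc' //=.
  have lv : loc v != None.
    move: lc; rewrite -vc' (ctr_loc ctr); case: ifP => // _ -> //.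
  rewrite gt_eqF // ltr_wpDr ?(RH_gt0 hd cov) //; apply: sumr_ge0 => u _.
  exact: cover_RH_ge0 cov u.
- move=> c c' cc'; apply/fdisjointP => k /(ctr_labels ctr)[v vc kv].
  apply/negP => /(ctr_labels ctr)[v' vc' kv'].
  by move: cc'; rewrite -vc -vc' (labels_disjoint kv kv') eqxx.
exists r => k; rewrite rE; split=> [[v kv]|[c /(ctr_labels ctr)[v _ kv]]]; last by exists v.
by exists (q v); apply/(ctr_labels ctr); exists v.
Qed.

Lemma cover_contraction : exists2 pC, (forall v, pC (q v) = p v) &
  is_cover d (\row_f x 0 (h f)) pC.
Proof.
have /choice[s sK] := ctr_surj ctr.
have pq v : p (s (q v)) = p v by apply: fiber_pot; rewrite sK.
exists (fun c => p (s c)) => //; split; first exact: tropical_curve_contraction.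
split.
- move=> f; rewrite mxE (ctr_weight ctr) (weight_gt0 cov) remaining_gt0; split=> //.
  by rewrite (ctr_tgt ctr) (ctr_src ctr) !pq (proj1 pot).
- move=> c; split; first exact: (potential_ge0 hd cov pot x_ge0).
  by rewrite -{2}(sK c); exact: pot_eq0_center.
- by split; [exact: loc_edge_contraction|exact: loc_end_contraction].
split; first exact: balanced_contraction.
- move=> c; rewrite RH_contraction; apply: sumr_ge0 => v _; exact: cover_RH_ge0 cov v.
- exact: card_labels_contraction.
rewrite -[RHS](cover_degree cov) big_mkcond [RHS]big_mkcond /=.
transitivity (\sum_c (fiber_degree c))%N.
  apply: eq_bigr => c _; rewrite -local_degree_contraction.
  by case: ifP => _; rewrite ?mul1n ?mul0n.
rewrite (big_fiberT _ q xpredT); apply: eq_bigr => v _.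
by case: ifP => _; rewrite ?mul1n ?mul0n.
Qed.

Lemma total_genus_contraction : total_genus C = total_genus A.
Proof.
have gA := total_genusE (cover_curve cov); have gC := total_genusE tropical_curve_contraction.
have : (\sum_c (genus c + #|[pred v | q v == c]|) = \sum_c
    (\sum_(v | q v == c) genus v + #|[pred e in Z | q (src e) == c]| + 1))%N.
  by apply: eq_bigr => c _; exact: ctr_genus ctr c.
rewrite !big_split /= (card_fiberT q xpredT) (big_fiberT _ q xpredT).
have -> : (\sum_c #|[pred e in Z | q (src e) == c]| = #|Z|)%N.
  rewrite -[RHS]sum1_card (partition_big (fun e => q (src e)) xpredT) //=.
  by apply: eq_bigr => c _; rewrite -sum1_card.
have := card_split_edges xpredT.
rewrite (eq_card (B := 'I_(nedge A)) (A := [pred e | xpredT e])) //.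
rewrite (eq_card (B := Z) (A := [pred e in Z | xpredT e])) => [|e]; last by rewrite !inE andbT.
rewrite (eq_card (B := 'I_(nedge C)) (A := [pred f | xpredT (h f)])) //.
rewrite !card_ord sum_nat_const card_ord.
move: gA gC.
set sA := (\sum_(_ < nvert A) _)%N; set sC := (\sum_(_ < nvert C) _)%N.
change (\big[_/0%N]_i genus i) with sA.
by move: (total_genus _) (total_genus _) sA sC #|_|; lia.
Qed.

End Transfer.

(** * The geometry of a cone *)

Local Open Scope classical_set_scope.

(** One [t] for finitely many strict inequalities: 1/(1 + s) works because each |a i| / b i is at
    most s. *)
Lemma small_scaling (R : realFieldType) (I : finType) (a b : I -> R) :
  (forall i, 0 < b i) -> exists2 t, 0 < t & forall i, t * `|a i| < b i.
Proof.
move=> b_gt0; pose s := \sum_i `|a i| / b i.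
have s_ge0 : 0 <= s by apply: sumr_ge0 => i _; rewrite divr_ge0 // ltW.
have s1 : 0 < 1 + s by rewrite ltr_pwDl.
exists (1 + s)^-1 => [|i]; first by rewrite invr_gt0.
rewrite mulrC ltr_pdivrMr // -ltr_pdivrMl // mulrC.
rewrite (le_lt_trans (y := s)) ?ltrDr ?ltr01 // /s (bigD1 i) //= lerDl.
by apply: sumr_ge0 => j _; rewrite divr_ge0 // ltW.
Qed.

Lemma has_dim_unique (R : realType) N (P : set 'rV[R]_N) m n :
  has_dim P m -> has_dim P n -> m = n.
Proof.
move=> [_ [U [<- U1 U2]]] [_ [W [<- W1 W2]]].
by congr (\dim _); apply/eqP; rewrite eqEsubv U2 // W2.
Qed.

Section ConeGeometry.
Variables (R : realType) (D : profile) (d : nat) (A : ctype D).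
Variables (x0 : 'rV[R]_(nedge A)) (p0 : 'I_(nvert A) -> R).
Hypotheses (hd : (0 < d)%N) (hD : forall a, partition_of d (D a)).
Hypothesis cov : is_cover d x0 p0.

Lemma cone_potential x : @cone D R A x <-> (forall e, 0 < x 0 e) /\ exists p, potential x p.
Proof.
split=> -[xgt]; first by move/(closing_condition_potential hd cov).
by move/(closing_condition_potential hd cov).
Qed.

Lemma cone_cover : @cone D R A x0.
Proof.
apply/cone_potential; split; first exact: length_gt0 cov.
by exists p0; exact: cover_potential cov.
Qed.

Lemma potential_comb t x p x' p' : @potential R D A x p -> potential x' p' ->
  potential (x + t *: x') (fun v => p v + t * p' v).
Proof.
move=> [pe pc] [pe' pc']; split=> [e|v lv]; last by rewrite pc // pc' // mulr0 addr0.
by rewrite pe pe' !mxE; ring.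
Qed.

(** A point satisfying the weak inequalities is approached by [x + t *: x0] with small positive [t].
    Conversely, if an equation failed at [x], a point of the cone close enough to [x] would violate
    it too. *)
Lemma closure_cone x : closure (@cone D R A) x <->
  (forall e, 0 <= x 0 e) /\ exists p, potential x p.
Proof.
split=> [clx|[xge [p pot]] B /nbhs_ballP[eps eps_gt0 sB]]; last first.
  have [t t_gt0 tx] := @small_scaling R _ (fun e => x0 0 e) (fun=> eps) (fun=> eps_gt0).
  exists (x + t *: x0); split.
    apply/cone_potential; split=> [e|].
      by rewrite !mxE ltr_wpDl // mulr_gt0 // (length_gt0 cov).
    by exists (fun v => p v + t * p0 v); apply: potential_comb => //; exact: cover_potential cov.
  apply: sB; split=> // i e; rewrite !mxE ord1.
  rewrite /ball /= opprD addrA subrr add0r normrN normrM gtr0_norm //.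
have near eps : 0 < eps -> exists2 y, cone y & forall e, `|x 0 e - y 0 e| < eps.
  move=> eps_gt0; have [y [cy [_ yx]]] := clx _ (nbhsx_ballx x eps eps_gt0).
  by exists y => // e; exact: yx.
split=> [e|].
  rewrite leNgt; apply/negP => xe.
  have [y [/(_ e) ye _] /(_ e)] := near (- x 0 e) ltac:(by rewrite oppr_gt0).
  by rewrite distrC ger0_norm ?subr_ge0; lra.
apply/(closing_condition_potential hd cov).
apply/colP => j; rewrite [RHS]mxE; apply/eqP/negPn/negP.
set M := map_mx _ _; rewrite -normr_gt0 => S_gt0.
have [t t_gt0 tM] := @small_scaling R _ (fun=> \sum_e `|M j e|) (fun _ : 'I_1 =>
    `|(M *m x^T) j 0|) (fun=> S_gt0).
have [y [_ My] yx] := near t t_gt0.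
have := tM ord0; rewrite ltNge => /negP[].
have -> : (M *m x^T) j 0 = (M *m (x - y)^T) j 0 by rewrite linearB /= mulmxBr My subr0.
rewrite mxE (le_trans (ler_norm_sum _ _ _)) // ger0_norm ?sumr_ge0 // mulr_sumr.
by apply: ler_sum => e _; rewrite normrM mulrC ler_wpM2r // !mxE ltW.
Qed.

Lemma open_polyhedron_cone : open_polyhedron (@cone D R A).
Proof.
split; first by exists x0; exact: cone_cover.
exists (glued_b1 A), (nedge A), (map_mx intr (cycle_matrix A))^T, 0, (- 1%:M), 0.
apply/seteqP; split=> x [] H1 H2.
  split=> [|j]; last by rewrite mulmxN mulmx1 !mxE oppr_lt0.
  by apply: trmx_inj; rewrite trmx_mul trmxK H2 trmx0.
split=> [e|]; first by have := H2 e; rewrite mulmxN mulmx1 !mxE oppr_lt0.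
by apply: trmx_inj; rewrite trmx_mul trmxK H1 trmx0.
Qed.

Let outer := [pred v | @loc _ A v != None].

(* The lengths as a linear function of the positions of the vertices not over c. *)
Definition lengths_mx : 'M[R]_(#|outer|, nedge A) :=
  \matrix_(i, e) (((tgt e == enum_val i)%:R - (src e == enum_val i)%:R) / (weight e)%:R).

Lemma lengths_mxP x p : potential x p -> x = (\row_(i < #|outer|) p (enum_val i)) *m lengths_mx.
Proof.
move=> [pe pc]; apply/rowP => e; rewrite mxE.
have sel v : \sum_(i < #|outer|) p (enum_val i) * (v == enum_val i)%:R = p v.
  case: (boolP (v \in outer)) => [ov|]; last first.
    rewrite inE negbK => /eqP lv; rewrite pc // big1 // => i _.
    have := enum_valP i; case: eqP => [<-|]; last by rewrite mulr0.
    by rewrite inE lv.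
  rewrite (bigD1 (enum_rank_in ov v)) //= enum_rankK_in // eqxx mulr1 big1 ?addr0 // => i iv.
  case: eqP => [vi|]; last by rewrite mulr0.
  by case/eqP: iv; apply: enum_val_inj; rewrite enum_rankK_in.
have w0 : (weight e)%:R != 0 :> R by rewrite pnatr_eq0 -lt0n (weight_gt0 cov).
apply: (mulIf w0); rewrite mulr_suml.
transitivity (p (tgt e) - p (src e)); first by rewrite pe; ring.
rewrite -!sel -sumrB; apply: eq_bigr => i _; rewrite !mxE.
by rewrite -mulrA divfK // mulrBr.
Qed.

Lemma potential_lengths_mx (s : 'rV[R]_#|outer|) : exists2 p,
  potential (s *m lengths_mx) p & forall i, p (enum_val i) = s 0 i.
Proof.
pose p v := \sum_(i < #|outer|) s 0 i * (v == enum_val i)%:R.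
exists p => [|i]; last first.
  rewrite /p (bigD1 i) //= eqxx mulr1 big1 ?addr0 // => j ji.
  by case: eqP => [/enum_val_inj ij|]; [rewrite ij eqxx in ji|rewrite mulr0].
split=> [e|v lv]; last first.
  rewrite /p big1 // => i _; have := enum_valP i; case: eqP => [<-|]; last by rewrite mulr0.
  by rewrite inE lv.
have w0 : (weight e)%:R != 0 :> R by rewrite pnatr_eq0 -lt0n (weight_gt0 cov).
apply/eqP; rewrite addrC -subr_eq; apply/eqP; rewrite -sumrB mxE mulr_sumr.
by apply: eq_bigr => i _; rewrite !mxE; field.
Qed.

(** The direction space is the image of [lengths_mx], which is injective because lengths determine
    positions. It is minimal: for [w] in it and small [t], [x0 + t *: w] stays in the cone, so [w]
    is a multiple of a difference of two cone points. *)
Lemma has_dim_cone : has_dim (@cone D R A) #|outer|.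
Proof.
split; first by exists x0; exact: cone_cover.
exists (limg (linfun (mulmxr lengths_mx))).
have mem x p : potential x p -> x \in limg (linfun (mulmxr lengths_mx)).
  move=> /lengths_mxP ->; apply/memv_imgP.
  by exists (\row_i p (enum_val i)); rewrite ?memvf // lfunE.
split.
- rewrite limg_dim_eq; first by rewrite dimvf dim_matrix; exact: mul1n.
  apply/eqP; rewrite capfv; apply/eqP/vspaceP => s; rewrite memv_ker memv0 lfunE /=.
  apply/eqP/eqP => [sM|->]; last by rewrite mul0mx.
  have [p pot ps] := potential_lengths_mx s; rewrite sM in pot.
  have pot0 : potential (0 : 'rV[R]_(nedge A)) (fun=> 0).
    by split=> // e; rewrite mxE mulr0 addr0.
  apply/rowP => i; rewrite -ps mxE; exact: (potential_unique hd cov pot pot0).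
- move=> x y /cone_potential[_ [p pot]] /cone_potential[_ [p' pot']].
  by have /mem := potential_comb (-1) pot pot'; rewrite scaleN1r.
move=> U UP; apply/subvP => w /memv_imgP[s _]; rewrite lfunE /= => wE.
have [p pot _] := potential_lengths_mx s; rewrite -wE in pot.
have [t t_gt0 tw] := @small_scaling R _ (fun e => w 0 e) (fun e => x0 0 e) (length_gt0 cov).
have : cone (x0 + t *: w).
  apply/cone_potential; split=> [e|].
    rewrite !mxE; have := tw e; rewrite -[t in t * _](gtr0_norm t_gt0) -normrM ltr_norml => /andP[].
    by lra.
  by exists (fun v => p0 v + t * p v); apply: potential_comb => //; exact: cover_potential cov.
move/UP => /(_ _ cone_cover); rewrite addrAC subrr add0r => twU.
by have := memvZ t^-1 twU; rewrite scalerA mulVf ?scale1r // gt_eqF.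
Qed.

(** The position is the weighted length of a path from c to [v], and the path does not depend on
    [x]. *)
Lemma position_linear v : exists c : 'cV[R]_(nedge A),
  forall x p, potential x p -> p v = (x *m c) 0 0.
Proof.
move: v; apply: (center_ind hd cov) => [v lv|e [c cP]].
  by exists 0 => x p [_ pc]; rewrite mulmx0 mxE pc.
exists (c + delta_mx e 0 *m ((weight e)%:R)%:M) => x p pot; rewrite (proj1 pot) (cP _ _ pot).
rewrite mulmxDr [RHS]mxE; congr (_ + _).
rewrite mulmxA -colE mul_mx_scalar !mxE //.
Qed.

End ConeGeometry.

(** * Finiteness of the set of types *)

Lemma card_mark (D : profile) : #|{: mark D}| = nparts D.
Proof.
rewrite /mark card_tagged sumnE big_map big_enum /nparts.
by apply: eq_bigr => a _; rewrite card_ord.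
Qed.

Section Bounds.
Variables (R : realType) (D : profile) (d : nat) (A : ctype D).
Variables (x0 : 'rV[R]_(nedge A)) (p0 : 'I_(nvert A) -> R).
Hypotheses (hd : (0 < d)%N) (hD : forall a, partition_of d (D a)).
Hypothesis cov : is_cover d x0 p0.

Lemma sum_valence : (\sum_v @valence D A v = 2 * nedge A + nparts D)%N.
Proof.
have cardT (I : finType) (f : I -> 'I_(nvert A)) : (\sum_v #|[pred i | f i == v]| = #|I|)%N.
  by rewrite (card_fiberT f xpredT); apply: eq_card => i; rewrite !inE.
by rewrite /valence !big_split /= !cardT card_ord card_mark; lia.
Qed.

(** Bounded edges count twice and ends once in the sum of valences; the formula for the total genus
    eliminates the numbers of edges and vertices. *)
Lemma sum_RH : \sum_v @RH_number D A v = (nparts D + 2 * total_genus A)%:Z - 2 - d%:Z.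
Proof.
have gA := total_genusE (cover_curve cov).
under eq_bigr => v _ do rewrite RH_split.
have sumz (F : 'I_(nvert A) -> nat) : \sum_v (F v)%:Z = (\sum_v F v)%N%:Z.
  by rewrite (big_morph Posz PoszD (erefl 0%:Z)).
rewrite !sumrB /= !sumz sum_nat_const card_ord big_split /= sum_valence -big_distrr /=.
have -> : (\sum_v ((@loc _ A v == None) * local_degree v) = d)%N.
  rewrite -(cover_degree cov) [RHS]big_mkcond; apply: eq_bigr => v _.
  by case: ifP => _; rewrite ?mul1n ?mul0n.
by move: gA; move: (\sum_(_ < _) _)%N; lia.
Qed.

Lemma card_outer_le : (#|[pred v | @loc _ A v != None]|)%:Z <= \sum_v @RH_number D A v.
Proof.
rewrite -sum1_card (big_morph Posz PoszD (erefl 0%:Z)) [leRHS](bigID (fun v => loc v != None)) /=.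
rewrite ler_wpDr //; first by apply: sumr_ge0 => v _; exact: cover_RH_ge0 cov v.
by apply: ler_sum => v lv; have := RH_gt0 hd cov lv; lia.
Qed.

Lemma card_outer_trivalent : trivalent A ->
  (#|[pred v | @loc _ A v != None]|)%:Z = \sum_v @RH_number D A v.
Proof.
move=> tri; rewrite -sum1_card (big_morph Posz PoszD (erefl 0%:Z)).
rewrite [RHS](bigID (fun v => loc v != None)) /= [X in _ = _ + X]big1 ?addr0 => [|v].
  apply: eq_bigr => v; rewrite inE; have := tri v; case lv: (loc v) => [a|] // [vv gv] _.
  by rewrite (RH_ray lv) vv gv.
by rewrite negbK => /eqP lv; have := tri v; rewrite lv.
Qed.

Lemma leq_nedge : (nedge A < total_genus A + nvert A)%N.
Proof. have := total_genusE (cover_curve cov); lia. Qed.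

Lemma leq_genus v : (@genus D A v <= total_genus A)%N.
Proof.
have := total_genusE (cover_curve cov); have := leq_nvert_nedge (cover_curve cov).
rewrite (bigD1 v) //=; move: (\sum_(_ < _ | _) _)%N; lia.
Qed.

(** By balancing such a vertex has no edges at all, so its RH-number is 2g - 2, which is nonnegative
    only for g >= 1. *)
Lemma degree0_genus v : loc v = None -> @local_degree D A v = 0%N -> (0 < genus v)%N.
Proof.
move=> lv dv; have := cover_RH_ge0 cov v; rewrite (RH_center lv) dv.
suff -> : valence v = 0%N by lia.
have w_gt0 e : (0 < @weight _ A e)%N by exact: weight_gt0 cov e.
have le e : loc (tgt e) != None /\ @loc _ A (src e) \in [:: None; loc (tgt e)].
  split; first exact: loc_tgt cov e.
  by rewrite !inE; case: (loc_src cov e) => ->; rewrite eqxx ?orbT.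
rewrite (valence_outcount v le) big1 => [|a _]; last first.
  apply/eqP; rewrite eqn0Ngt (outcount_gt0 v w_gt0 (part_gt0 hD)).
  by rewrite (balanced_center lv (@cover_balanced _ _ _ _ _ _ cov v)) dv.
apply: eq_card0 => e; rewrite !inE; apply/eqP => ev.
by have := loc_tgt cov e; rewrite ev lv.
Qed.

(** Off c each vertex uses up at least 1 of the total RH-number; over c each vertex uses up at least
    1 of the degree or of the genus. *)
Lemma leq_nvert : (nvert A <= nparts D + 3 * total_genus A)%N.
Proof.
have := card_outer_le; rewrite sum_RH => outer.
have : (#|[pred v | @loc _ A v == None]| <= \sum_(v | loc v == None) (local_degree v + @genus _ A v))%N.
  rewrite -sum1_card; apply: leq_sum => v /eqP lv.
  by have := @degree0_genus v lv; lia.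
rewrite big_split /= (cover_degree cov) => inner.
have gsum : (\sum_(v | @loc _ A v == None) genus v <= total_genus A)%N.
  apply: leq_trans (_ : \sum_v @genus _ A v <= _)%N.
    by rewrite [leqRHS](bigID (fun v => loc v == None)) /= leq_addr.
  have := total_genusE (cover_curve cov); have := leq_nvert_nedge (cover_curve cov); lia.
have : (#|[pred v | @loc _ A v == None]| <= d + total_genus A)%N.
  by apply: leq_trans inner _; rewrite leq_add2l.
have : (#|[pred v | @loc _ A v == None]| + #|[pred v | @loc _ A v != None]| = nvert A)%N.
  by rewrite -[RHS]card_ord -(cardC [pred v | @loc _ A v == None]); congr addn; exact: eq_card.
move: outer; move: #|_| #|_| => a b.
by clear inner gsum; lia.
Qed.

(* The total weight entering the part of a ray at distance at least p(tgt e)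
   leaves it through the ends. *)
Lemma leq_weight (e : 'I_(nedge A)) : (weight e <= \sum_(m : mark D) part m)%N.
Proof.
case le: (@loc _ A (tgt e)) => [a|]; last by have := loc_tgt cov e; rewrite le.
pose S v := (loc v == Some a) && (p0 (tgt e) <= p0 v).
have flow : (\sum_(v | S v) outflow v a = \sum_(v | S v)
    \sum_(f | (tgt f == v) && (loc (tgt f) == Some a)) weight f)%N.
  apply: eq_bigr => v /andP[/eqP lv _].
  by rewrite (flow_eq cov) lv mul0n addn0.
move: flow; rewrite big_split /= !big_fiber => flow.
have ends : (\sum_(m | S (end_at A m) && (tag m == a)) part m <= \sum_(m : mark D) part m)%N.
  by rewrite [leqRHS](bigID (fun m => S (end_at A m) && (tag m == a))) leq_addr.
apply: leq_trans ends.
have St : S (tgt e) by rewrite /S le eqxx lexx.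
have Ss : ~~ S (src e).
  by apply/negP => /andP[_ /(lt_le_trans (cover_pot_lt cov e))]; rewrite ltxx.
(* An edge on the ray that starts in [S] also ends in [S], whereas [e] ends in [S] without starting
   there. *)
suff : (\sum_(i | S (src i) && (loc (tgt i) == Some a)) weight i + weight e <=
  \sum_(i | S (tgt i) && (loc (tgt i) == Some a)) weight i)%N.
  by rewrite -flow leq_add2l.
rewrite addnC [leqRHS](bigD1 e) ?St ?le ?eqxx //= leq_add2l.
rewrite big_mkcond [leqRHS]big_mkcond; apply: leq_sum => f _.
case: ifP => // /andP[Sf lf]; rewrite ifT //.
rewrite lf (_ : f != e) ?andbT; last by apply: contra Ss => /eqP <-.
by rewrite /S lf /=; case/andP: Sf => _ /le_trans; apply; rewrite ltW // (cover_pot_lt cov).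
Qed.

(** The labels fill {1, ..., r}, so the largest one is at most their number, which is the sum of the
    RH-numbers. *)
Lemma leq_label v k : k \in @labels D A v -> (k <= nparts D + 2 * total_genus A)%N.
Proof.
move=> kv; have [_ _ _ dis [r rE]] := cover_curve cov.
pose U := (\big[fsetU/fset0]_v @labels _ A v)%fset.
have cU : #|` U|%:Z = \sum_v @RH_number D A v.
  rewrite card_bigfcup_disjoint ?index_enum_uniq // (big_morph Posz PoszD (erefl 0%:Z)).
  by apply: eq_bigr => u _; exact: cover_card_labels cov u.
have : (0 < k <= r)%N by apply/rE; exists v.
case/andP => _ kr.
have : (size (iota 1 r) <= size U)%N.
  apply: uniq_leq_size; first exact: iota_uniq.
  move=> l; rewrite mem_iota add1n ltnS => /rE[u lu].
  by apply/bigfcupP; exists u; rewrite // mem_index_enum.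
by move: cU; rewrite sum_RH size_iota; lia.
Qed.

End Bounds.

(** * Finitely many types with bounded data *)

Section Codes.
Variables (D : profile) (N M G W L : nat).

Definition bounded_type (A : ctype D) : Prop :=
  [/\ (nvert A < N)%N, (nedge A < M)%N, forall v, (@genus D A v < G)%N,
      forall e, (@weight D A e < W)%N & forall v k, k \in @labels D A v -> (k < L)%N].

(** A finite copy of the fields of [ctype]: once all numbers are bounded, every field takes values
    in a finite type. *)
Definition type_code : finType := {nv : 'I_N & {ne : 'I_M &
  (({ffun 'I_ne -> 'I_nv} * {ffun 'I_ne -> 'I_nv}) * {ffun mark D -> 'I_nv} *
   ({ffun 'I_nv -> 'I_G} * {ffun 'I_nv -> {set 'I_L}}) *
   ({ffun 'I_ne -> 'I_W} * {ffun 'I_nv -> option 'I_3}))%type}}.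

Definition decode (c : type_code) : ctype D :=
  let: existT nv (existT ne (s, t, en, (ge, la), (we, lo))) := c in
  @CType D nv ne s t en (fun v => ge v)
    (fun v => seq_fset tt [seq val i | i <- enum (la v)]) (fun e => we e) lo.

Lemma decode_surj (A : ctype D) : bounded_type A -> exists c, decode c = A.
Proof.
case: A => nv ne s t en ge la we lo [/= hv he hg hw hl].
exists (existT _ (Ordinal hv) (existT _ (Ordinal he)
  ([ffun e => s e], [ffun e => t e], [ffun m => en m],
   ([ffun v => Ordinal (hg v)], [ffun v => finset (fun i : 'I_L => val i \in la v)]),
   ([ffun e => Ordinal (hw e)], [ffun v => lo v])))).
rewrite /decode; congr CType; apply/funext => i; rewrite ?ffunE //.
apply/fsetP => k; rewrite seq_fsetE; apply/mapP/idP => [[j + ->]|ki].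
  by rewrite mem_enum inE.
by exists (Ordinal (hl _ _ ki)) => //; rewrite mem_enum inE.
Qed.

Lemma finite_bounded_types : finite_set bounded_type.
Proof.
apply: (@sub_finite_set _ _ (decode @` [set: type_code])).
  by move=> A /decode_surj[c <-]; exists c.
exact/finite_image/finite_finset.
Qed.

End Codes.

(** * The moduli space *)

Local Open Scope quotient_scope.

(** * Points of closed cones and the covers they represent *)

Section Degenerations.
Variables (R : realType) (D : profile) (d : nat).
Hypotheses (hd : (0 < d)%N) (hD : forall a, partition_of d (D a)).
Implicit Types A B C E : ctype D.

(* The point x of the closed cone of A is the cover of type C with lengths y. *)
Definition degenerates A (x : 'rV[R]_(nedge A)) C (y : 'rV[R]_(nedge C)) : Prop :=
  exists q h, @is_contraction D A (zero_edges x) C q h /\ forall f, y 0 f = x 0 (h f).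

Lemma degenerates_contraction A (x : 'rV[R]_(nedge A)) : is_type R d A ->
    degenerates x (@remaining_lengths D R A x).
Proof.
move=> [x0 [p0 cov]]; exists (comp_of _), enum_val.
by split=> [|f]; [exact: contraction_is_contraction cov _|rewrite mxE].
Qed.

Lemma degenerates_unique A (x : 'rV[R]_(nedge A)) C (y : 'rV[R]_(nedge C)) C' (y' :
    'rV[R]_(nedge C')) :
  @degenerates A x C y -> @degenerates A x C' y' -> cover_iso y y'.
Proof.
move=> [q [h [ctr yx]]] [q' [h' [ctr' yx']]].
have [f [k [iso _ hk]]] := contraction_unique ctr ctr'.
by exists f, k; split=> // e; rewrite yx yx' hk.
Qed.

Lemma contraction_iso A Z C q h E f k : @is_contraction D A Z C q h -> @is_type_iso D C E f k ->
  exists k', [/\ is_contraction Z (f \o q) (h \o k'), cancel k k' & cancel k' k].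
Proof.
move=> ctr iso; have [_ [k' kK k'K] _ _ _] := iso; exists k'; split=> //.
have := contraction_comp ctr (iso_is_contraction iso kK k'K).
by rewrite imset0 finset.setU0.
Qed.

Lemma degenerates_iso A (x : 'rV[R]_(nedge A)) C (y : 'rV[R]_(nedge C)) C' (y' :
    'rV[R]_(nedge C')) :
  @degenerates A x C y -> @cover_iso D R C y C' y' -> degenerates x y'.
Proof.
move=> [q [h [ctr yx]]] [f [k [iso yy']]].
have [k' [ctr' kK k'K]] := contraction_iso ctr iso.
by exists (f \o q), (h \o k'); split=> // e; rewrite /= -yx -yy' k'K.
Qed.

Lemma zero_edges_pos A (x : 'rV[R]_(nedge A)) : (forall e, 0 < x 0 e) -> zero_edges x = finset.set0.
Proof. by move=> xgt; apply/setP => e; rewrite !inE gt_eqF. Qed.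

Lemma degenerates_of_iso A (x : 'rV[R]_(nedge A)) C (y : 'rV[R]_(nedge C)) :
  (forall e, 0 < x 0 e) -> cover_iso x y -> degenerates x y.
Proof.
move=> xgt [f [k [iso xy]]]; have [_ [k' kK k'K] _ _ _] := iso.
exists f, k'; split; last by move=> e; rewrite -xy k'K.
by rewrite zero_edges_pos //; exact: iso_is_contraction iso kK k'K.
Qed.

Lemma degenerates_refl A (x : 'rV[R]_(nedge A)) : (forall e, 0 < x 0 e) -> degenerates x x.
Proof. by move/degenerates_of_iso; apply; exact: cover_iso_refl. Qed.

Lemma degenerates_pos_iso A (x : 'rV[R]_(nedge A)) C (y : 'rV[R]_(nedge C)) : (forall e,
    0 < x 0 e) -> @degenerates A x C y -> cover_iso x y.
Proof. by move=> xgt; apply: degenerates_unique; exact: degenerates_refl. Qed.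

Definition closed_cone_point A (x : 'rV[R]_(nedge A)) : Prop :=
  (forall e, 0 <= x 0 e) /\ exists p, potential x p.

Lemma closure_coneP A (x : 'rV[R]_(nedge A)) : is_type R d A -> closure (@cone D R A) x <->
    closed_cone_point x.
Proof. by move=> [x0 [p0 cov]]; exact: closure_cone hd cov x. Qed.

Lemma conePC A (x : 'rV[R]_(nedge A)) : is_type R d A ->
  cone x <-> (forall e, 0 < x 0 e) /\ exists p, potential x p.
Proof. by move=> [x0 [p0 cov]]; exact: cone_potential hd cov x. Qed.

Lemma cone_closed A (x : 'rV[R]_(nedge A)) : is_type R d A -> cone x -> closed_cone_point x.
Proof.
by move=> tA /(conePC _ tA)[xgt pot]; split=> // e; exact: ltW.
Qed.

Lemma degenerates_cover A (x : 'rV[R]_(nedge A)) C (y : 'rV[R]_(nedge C)) : is_type R d A ->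
    closed_cone_point x -> @degenerates A x C y ->
  exists p, is_cover d y p.
Proof.
move=> [x0 [p0 cov]] [xge [p pot]] [q [h [ctr yx]]].
have [pC _ covC] := cover_contraction hd hD cov pot xge ctr.
by exists pC; rewrite (_ : y = \row_f x 0 (h f)) //; apply/rowP => f; rewrite mxE yx.
Qed.

Lemma degenerates_cone A (x : 'rV[R]_(nedge A)) C (y : 'rV[R]_(nedge C)) : is_type R d A ->
    closed_cone_point x -> @degenerates A x C y ->
  is_type R d C /\ cone y.
Proof.
move=> tA cx dxy; have [p cov] := degenerates_cover tA cx dxy.
by split; [exists y, p|exact: cone_cover hd cov].
Qed.

Lemma degenerates_genus A (x : 'rV[R]_(nedge A)) C (y : 'rV[R]_(nedge C)) : is_type R d A ->
    closed_cone_point x -> @degenerates A x C y ->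
  total_genus C = total_genus A.
Proof.
move=> [x0 [p0 cov]] [xge [p pot]] [q [h [ctr yx]]].
exact (total_genus_contraction hd hD cov pot xge ctr).
Qed.

(* Points of the closed cone of a contraction of A are points of a face of the
   closed cone of A. *)
Lemma degenerates_lift A Z C q h (y : 'rV[R]_(nedge C)) :
  @is_contraction D A Z C q h -> closed_cone_point y ->
  exists2 x : 'rV[R]_(nedge A), closed_cone_point x &
    forall E (z : 'rV[R]_(nedge E)), degenerates y z -> degenerates x z.
Proof.
move=> ctr [yge [p [pe pc]]].
(* The lengths [y] extended by 0 to [Z]; as [h] is injective, the sum has at most one term. The
   positions are [p \o q]. *)
pose x : 'rV[R]_(nedge A) := \row_e \sum_(f | h f == e) y 0 f.
have xh f : x 0 (h f) = y 0 f.
  rewrite mxE (bigD1 f) //= big1 ?addr0 // => f' /andP[/eqP/(ctr_inj ctr)->].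
  by rewrite eqxx.
have xZ e : e \in Z -> x 0 e = 0.
  move=> eZ; rewrite mxE big_pred0 // => f; apply/eqP => fe.
  have : h f \notin Z by apply/(ctr_edges ctr); exists f.
  by rewrite fe eZ.
have xzero : zero_edges x = (Z :|: h @: zero_edges y)%SET.
  apply/setP => e; rewrite finset.in_setU inE; case: (boolP (e \in Z)) => [/xZ->|];
      first by rewrite eqxx.
  move=> /(ctr_edges ctr)[f <-]; rewrite xh mem_imset ?inE //; exact: ctr_inj ctr.
exists x.
  split=> [e|]; first by rewrite mxE sumr_ge0.
  exists (p \o q); split=> [e|v lv] /=; last first.
    by apply: pc; rewrite (ctr_loc ctr) lv; case: ifP.
  case: (boolP (e \in Z)) => [eZ|/(ctr_edges ctr)[f <-]].
    rewrite xZ // mulr0 addr0; congr p; apply/(ctr_fiber ctr).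
    by rewrite (adjZ_sym Z); apply: connect1; exact: adjZ_edge.
  by rewrite xh -(ctr_src ctr) -(ctr_tgt ctr) -(ctr_weight ctr) pe.
move=> E z [q' [h' [ctr' zy]]]; exists (q' \o q), (h \o h'); split=> [|f].
  by rewrite xzero; exact: contraction_comp ctr ctr'.
by rewrite zy /= xh.
Qed.

Lemma outer_label A v : is_type R d A -> @loc D A v != None -> exists k, k \in labels v.
Proof.
move=> [x0 [p0 cov]] lv; have := RH_gt0 hd cov lv; rewrite -(cover_card_labels cov).
by rewrite ltz_nat cardfs_gt0 => /fset0Pn.
Qed.

(* Vertices not over c are recognized by their labels. *)
Lemma same_position A (x : 'rV[R]_(nedge A)) p B (x' : 'rV[R]_(nedge B)) p'
    C (z : 'rV[R]_(nedge C)) v u k :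
  is_type R d A -> is_type R d B -> (forall e, 0 <= x 0 e) -> (forall e, 0 <= x' 0 e) ->
  potential x p -> potential x' p' -> degenerates x z -> degenerates x' z ->
  k \in labels v -> k \in labels u -> p v = p' u.
Proof.
move=> [x0 [p0 cov]] [x1 [p1 cov1]] xge xge' pot pot' [q [h [ctr zx]]] [q' [h' [ctr' zx']]] kv ku.
have [pC pCp covC] := cover_contraction hd hD cov pot xge ctr.
have [pC' pCp' covC'] := cover_contraction hd hD cov1 pot' xge' ctr'.
have zE : \row_f x 0 (h f) = \row_f x' 0 (h' f) :> 'rV[R]_(nedge C).
  by apply/rowP => f; rewrite !mxE -zx.
have potC := cover_potential covC; have potC' := cover_potential covC'.
rewrite -zE in potC'.
have pCC := potential_unique hd covC potC potC'.
rewrite -pCp -pCp' pCC; congr pC'; apply: (labels_disjoint covC (k := k)).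
  by apply/(ctr_labels ctr); exists v.
by apply/(ctr_labels ctr'); exists u.
Qed.

Lemma length_position A (x : 'rV[R]_(nedge A)) p e : is_type R d A -> potential x p ->
  x 0 e = (p (tgt e) - p (src e)) / (weight e)%:R.
Proof.
move=> [x0 [p0 cov]] [-> _]; rewrite addrC addKr mulrC mulKf //.
by rewrite pnatr_eq0 -lt0n (weight_gt0 cov).
Qed.

Lemma degenerates_inj A (x x' : 'rV[R]_(nedge A)) C (z : 'rV[R]_(nedge C)) :
  is_type R d A -> closed_cone_point x -> closed_cone_point x' ->
  degenerates x z -> degenerates x' z -> x = x'.
Proof.
move=> tA [xge [p pot]] [xge' [p' pot']] xz xz'.
have pp' v : p v = p' v.
  case lv: (loc v) => [a|]; last by rewrite (proj2 pot) // (proj2 pot').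
  have [|k kv] := @outer_label A v tA; first by rewrite lv.
  exact: (same_position tA tA xge xge' pot pot' xz xz' kv kv).
by apply/rowP => e; rewrite (length_position e tA pot) (length_position e tA pot') !pp'.
Qed.

Lemma degenerates_transition A B : is_type R d A -> is_type R d B ->
  exists T : 'M[R]_(nedge A, nedge B), forall (x : 'rV[R]_(nedge A)) (y :
      'rV[R]_(nedge B)) C (z : 'rV[R]_(nedge C)),
    closed_cone_point x -> closed_cone_point y -> degenerates x z -> degenerates y z ->
    y = x *m T.
Proof.
move=> tA tB.
have pos v : exists c : 'cV[R]_(nedge A), forall (x : 'rV[R]_(nedge A)) (y :
    'rV[R]_(nedge B)) p C (z : 'rV[R]_(nedge C)),
    closed_cone_point x -> (forall e, 0 <= y 0 e) -> @potential R D B y p ->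
    degenerates x z -> degenerates y z -> p v = (x *m c) 0 0.
  case lv: (loc v) => [a|]; last first.
    by exists 0 => x y p C z _ _ [_ pc] _ _; rewrite pc // mulmx0 mxE.
  have [|k kv] := @outer_label B v tB; first by rewrite lv.
  case: (pselect (exists u, k \in @labels _ A u)) => [[u ku]|nu].
    have [x0 [p0 cov]] := tA; have [c cP] := position_linear hd cov u.
    exists c => x y p C z [xge [px potx]] yge poty xz yz.
    by rewrite (same_position tB tA yge xge poty potx yz xz kv ku) (cP _ _ potx).
  (* A common degeneration would carry the label [k] of [v], hence so would [A]. In this case there
     is no pair [x], [y] to consider, and any vector will do. *)
  exists 0 => x y p C z _ _ _ [q [h [ctr _]]] [q' [h' [ctr' _]]]; case: nu.
  have : k \in labels (q' v) by apply/(ctr_labels ctr'); exists v.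
  by case/(ctr_labels ctr) => u _ ku; exists u.
have /choice[c cP] := pos.
exists (\matrix_(i, e) ((c (tgt e) i 0 - c (src e) i 0) / (weight e)%:R)).
move=> x y C z cx [yge [p pot]] xz yz; apply/rowP => e.
rewrite (length_position e tB pot) !(cP _ _ _ _ _ _ cx yge pot xz yz) !mxE.
rewrite -sumrB mulr_suml; apply: eq_bigr => i _; rewrite !mxE; ring.
Qed.

End Degenerations.

(** * Cells, gluing, maximal cones and dimension *)

Section Moduli.
Variables (R : realType) (g d : nat) (D : profile).
Hypotheses (hd : (0 < d)%N) (hD : forall a, partition_of d (D a)).
Hypothesis hdim : (d + 2 <= nparts D + 2 * g)%N.
Implicit Types A B C E : ctype D.
Local Notation n := (nparts D + 2 * g - 2 - d)%N.

Lemma moduli_type A : moduli_types R g d A -> is_type R d A.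
Proof. by case=> -[]. Qed.

Lemma moduli_sum_RH A : genus_type R g d A -> \sum_v @RH_number D A v = n%:Z.
Proof.
move=> [[x0 [p0 cov]] gA]; rewrite (sum_RH hd cov) gA.
by move: hdim; lia.
Qed.

(** This trades the types [contracted_type p] and [contracted_type q], which depend on the points,
    for an arbitrary common target. *)
Lemma same_coverP (p q : closed_cones R g d D) : same_cover p q <->
  exists C (z : 'rV[R]_(nedge C)),
      degenerates (set_val (tagged p)) z /\ degenerates (set_val (tagged q)) z.
Proof.
have tp := moduli_type (set_valP (tag p)); have tq := moduli_type (set_valP (tag q)).
split=> [/asboolP iso|[C [z [pz qz]]]].
  exists (contracted_type q), (contracted_lengths q); split; last exact: degenerates_contraction tq.
  exact: degenerates_iso (degenerates_contraction _ tp) iso.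
apply/asboolP; apply: cover_iso_trans (degenerates_unique (degenerates_contraction _ tp) pz) _.
exact: degenerates_unique qz (degenerates_contraction _ tq).
Qed.

Lemma pi_eqP (p q : closed_cones R g d D) :
  (\pi_({eq_quot (@same_cover_equivRel R g d D)}) p : moduli_space R g d D) =
      \pi_({eq_quot (@same_cover_equivRel R g d D)}) q <->
  exists C (z : 'rV[R]_(nedge C)),
      degenerates (set_val (tagged p)) z /\ degenerates (set_val (tagged q)) z.
Proof. by rewrite -same_coverP; split=> [/eqmodP|H]; last exact/eqmodP. Qed.

Lemma moduli_embP k l x y : @moduli_emb R g d D k x = @moduli_emb R g d D l y <->
  exists C (z : 'rV[R]_(nedge C)), degenerates (set_val x) z /\ degenerates (set_val y) z.
Proof. exact: pi_eqP. Qed.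

Lemma genus_type_degenerates A (x : 'rV[R]_(nedge A)) C (z : 'rV[R]_(nedge C)) :
  genus_type R g d A -> closed_cone_point x -> degenerates x z -> genus_type R g d C.
Proof.
move=> [tA gA] cx xz; split; first by have [] := degenerates_cone hd hD tA cx xz.
by rewrite (degenerates_genus hd hD tA cx xz).
Qed.

Lemma type_iso_sym A B : @type_iso D A B -> type_iso B A.
Proof. by move=> /(type_iso_cover_iso R)/cover_iso_sym/(type_iso_cover_iso R). Qed.

Lemma cover_iso_type A (x : 'rV[R]_(nedge A)) B (y : 'rV[R]_(nedge B)) :
  cover_iso x y -> type_iso A B.
Proof. by move=> [f [h [iso _]]]; exists f, h. Qed.

Lemma trivalent_iso A B : is_type R d A -> type_iso A B -> @trivalent D A -> trivalent B.
Proof.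
move=> [x0 [p0 cov]] [f [k iso]] tri v'.
have [[f' fK f'K] [k' kK k'K] _ _ Hv] := iso.
have ctr := iso_is_contraction iso kK k'K.
(* [RH_contraction] speaks of the zero edges of a point; the lengths of an actual cover provide a
   point with none. *)
rewrite -(@zero_edges_pos R D A x0) in ctr; last exact: length_gt0 cov.
have RHf v : RH_number (f v) = RH_number v.
  rewrite (RH_contraction hd cov (cover_potential cov) (fun e => ltW (length_gt0 cov e)) ctr).
  by rewrite (eq_bigl (pred1 v)) ?big_pred1_eq // => u /=; apply/eqP/eqP => [/(can_inj fK)|->].
rewrite -(f'K v'); have [gf _ lf] := Hv (f' v'); have := tri (f' v'); have := RHf (f' v').
rewrite lf; case lv: (loc (f' v')) => [a|] => [|-> //].
rewrite (RH_ray lv) (RH_ray (etrans lf lv)) gf => rh [vv gv]; rewrite gv; split=> //.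
by move: rh; rewrite vv gv; lia.
Qed.

(** The two alternatives of [moduli_types] become one: a trivalent type is the contraction of no
    edge of itself. *)
Lemma contraction_trivalent A : moduli_types R g d A -> exists B Z q h,
  [/\ genus_type R g d B, trivalent B & @is_contraction D B Z A q h].
Proof.
case=> -[tA gA] [tri|[B [x [tB triB clx [f [k iso]]]]]].
  have [x0 [p0 cov]] := tA.
  have [q [h [ctr _]]] := degenerates_refl (length_gt0 cov).
  by exists A, (zero_edges x0), q, h.
have [x0 [p0 cov]] := proj1 tB.
have [k' [ctr _ _]] := contraction_iso (contraction_is_contraction cov (zero_edges x)) iso.
by exists B, (zero_edges x), (f \o @comp_of _ B (zero_edges x)), (enum_val \o k').
Qed.

(** Every boundary point thus represents a cover whose type is again in the moduli space: the point
    lifts to a face of the closed cone of a trivalent type, and contractions compose. *)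
Lemma moduli_types_degenerates A (x : 'rV[R]_(nedge A)) C (z : 'rV[R]_(nedge C)) :
  moduli_types R g d A -> closed_cone_point x -> degenerates x z -> moduli_types R g d C.
Proof.
move=> mA cx xz; have [gA _] := mA.
split; first exact: genus_type_degenerates gA cx xz.
right; have [B [Z [q [h [gB triB ctr]]]]] := contraction_trivalent mA.
have [x' cx' lift] := degenerates_lift ctr cx.
exists B, x'; split=> //; first exact/(closure_coneP hd _ (proj1 gB)).
apply: cover_iso_type (degenerates_unique (degenerates_contraction x' (proj1 gB)) _).
exact: lift xz.
Qed.

Lemma class_type_iso A : moduli_types R g d A ->
  exists k : type_class R g d D, type_iso A (set_val (class_type k)).
Proof.
move=> mA; pose a : set_type (moduli_types R g d (D:=D)) := SigSub (mem_set mA).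
exists (\pi_({eq_quot (@same_type_equivRel R g d D)}) a).
have /eqmodP/asboolP : a =
    repr (\pi_({eq_quot (@same_type_equivRel R g d D)}) a) %[mod {eq_quot (@same_type_equivRel R g d D)}] by rewrite reprK.
by [].
Qed.

Lemma class_type_inj (k l : type_class R g d D) :
  type_iso (set_val (class_type k)) (set_val (class_type l)) -> k = l.
Proof.
move=> iso; rewrite -[k]reprK -[l]reprK.
by apply/eqmodP/asboolP.
Qed.

Lemma class_moduli (k : type_class R g d D) : moduli_types R g d (set_val (class_type k)).
Proof. exact: set_valP. Qed.

Local Notation cells k := (@moduli_cell R g d D k).
Local Notation image k :=
    (@cell_image R (moduli_space R g d D) (type_class R g d D) (@moduli_amb R g d D) (@moduli_cell R g d D) (@moduli_emb R g d D) k).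
Local Notation closed_image k :=
    (@closed_cell_image R (moduli_space R g d D) (type_class R g d D) (@moduli_amb R g d D) (@moduli_cell R g d D) (@moduli_emb R g d D) k).

Lemma closed_point k (x : set_type (closure (cells k))) : closed_cone_point (set_val x).
Proof. exact/(closure_coneP hd _ (moduli_type (class_moduli k)))/set_valP. Qed.

Lemma lift_point k (x : 'rV[R]_(moduli_amb k)) :
    @closed_cone_point R D (set_val (class_type k)) x ->
  exists y : set_type (closure (cells k)), set_val y = x.
Proof.
by move/(closure_coneP hd _ (moduli_type (class_moduli k))) => clx; exists (SigSub (mem_set clx)).
Qed.

Lemma cell_pos k (x : 'rV[R]_(moduli_amb k)) : cells k x -> forall e, 0 < x 0 e.
Proof. by move/(conePC hd x (moduli_type (class_moduli k))) => []. Qed.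

Lemma cell_of_degenerates A (x : 'rV[R]_(nedge A)) C (z : 'rV[R]_(nedge C)) k :
  is_type R d A -> closed_cone_point x -> degenerates x z -> type_iso C (set_val (class_type k)) ->
  exists2 y : 'rV[R]_(moduli_amb k), cells k y & degenerates x y.
Proof.
move=> tA cx xz [f [h iso]]; have [_ [h' hK h'K] _ _ _] := iso.
pose y : 'rV[R]_(moduli_amb k) := \row_e z 0 (h' e).
have xy : degenerates x (y : 'rV[R]_(nedge (set_val (class_type k)))).
  by apply: degenerates_iso xz _; exists f, h; split=> // e; rewrite mxE hK.
by exists y => //; have [] := degenerates_cone hd hD tA cx xy.
Qed.

(** The cell is that of the contracted cover. It is unique because a point with positive lengths
    degenerates only to covers isomorphic to itself. *)
Lemma cell_exists_unique (p : moduli_space R g d D) : exists! k, image k p.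
Proof.
have [[a x] ->] : exists q : closed_cones R g d D, p =
    \pi_({eq_quot (@same_cover_equivRel R g d D)}) q.
  by exists (repr p); rewrite reprK.
have ma := set_valP a; have ta := moduli_type ma.
have cx : closed_cone_point (set_val x) by apply/(closure_coneP hd _ ta); exact: set_valP.
have xz := degenerates_contraction (set_val x) ta.
have [k iso] := class_type_iso (moduli_types_degenerates ma cx xz).
have [y cy xy] := cell_of_degenerates ta cx xz iso.
have yy := degenerates_refl (cell_pos cy).
have [y' y'E] := lift_point (cone_closed hd (moduli_type (class_moduli k)) cy).
exists k; split=> [|l [w cw wE]].
  exists y'; first by rewrite /= y'E.
  by apply/pi_eqP; exists (set_val (class_type k)), y; rewrite /= y'E.
apply: class_type_inj.
move/pi_eqP : wE => [C [u [wu xu]]].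
have yu := degenerates_unique xy xu.
have wu' := degenerates_pos_iso (cell_pos cw) wu.
exact: cover_iso_type (cover_iso_trans yu (cover_iso_sym wu')).
Qed.

Lemma moduli_emb_continuous k : continuous (@moduli_emb R g d D k).
Proof.
move=> x; apply: (@continuous_comp _ _ _ (existT (@closed_cone R g d D) (class_type k))
  (\pi_({eq_quot (@same_cover_equivRel R g d D)}) : _ -> moduli_space R g d D)).
  exact: existT_continuous.
exact: pi_continuous.
Qed.

Lemma moduli_emb_injective k : injective (@moduli_emb R g d D k).
Proof.
move=> x y /moduli_embP[C [z [xz yz]]]; apply: val_inj.
exact: (degenerates_inj hd hD (moduli_type (class_moduli k)) (closed_point x) (closed_point y) xz yz).
Qed.

Lemma moduli_transition k l : exists T : 'M[R]_(moduli_amb l, moduli_amb k), forall x y,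
  @moduli_emb R g d D l x = @moduli_emb R g d D k y -> set_val y = set_val x *m T.
Proof.
have [T TP] := degenerates_transition hd hD (moduli_type (class_moduli l)) (moduli_type (class_moduli k)).
exists T => x y /moduli_embP[C [z [xz yz]]].
exact: TP (closed_point x) (closed_point y) xz yz.
Qed.

Lemma finite_type_class : finite_set [set: type_class R g d D].
Proof.
pose f (k : type_class R g d D) := set_val (class_type k).
have finj : injective f.
  move=> k l kl; apply: class_type_inj; rewrite -/(f k) kl.
  by apply/(type_iso_cover_iso R); exact: cover_iso_refl.
have -> : [set: type_class R g d D] = f @^-1` (@moduli_types R g d D).
  by apply/seteqP; split=> // k _; exact: class_moduli.
apply: finite_preimage; first by move=> k l _ _; exact: finj.
(* A common bound for all data: at most [nparts D + 3 * g] vertices, fewer than g more edges, and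
   weights at most the sum of the parts. The successor makes the bounds strict. *)
pose m := (nparts D + 4 * g + \sum_(m : mark D) part m).+1%N.
apply: sub_finite_set (finite_bounded_types D m m m m m) => A [[[x0 [p0 cov]] gA] _].
rewrite /m -gA; split.
- by have := leq_nvert hd hD cov; lia.
- by have := leq_nvert hd hD cov; have := leq_nedge hd cov; lia.
- by move=> v; have := leq_genus hd cov v; lia.
- by move=> e; have := leq_weight cov e; lia.
- by move=> v k kv; have := leq_label hd cov kv; lia.
Qed.

Lemma moduli_polyhedral_complex :
  @polyhedral_complex R (moduli_space R g d D) (type_class R g d D)
    (@moduli_amb R g d D) (@moduli_cell R g d D) (@moduli_emb R g d D).
Proof.
split.
- exact: finite_type_class.
- by move=> k; have [x0 [p0 cov]] := moduli_type (class_moduli k);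
    exact: open_polyhedron_cone hd cov.
- by move=> k; split; [exact: moduli_emb_continuous|exact: moduli_emb_injective].
- exact: cell_exists_unique.
- exact: moduli_transition.
Qed.

Lemma face_of_trivalent k : exists2 l, trivalent (set_val (class_type l)) &
  image k `<=` closed_image l.
Proof.
have [B [Z [q [h [gB triB ctr]]]]] := contraction_trivalent (class_moduli k).
have mB : moduli_types R g d B by split=> //; left.
have [l iso] := class_type_iso mB.
exists l; first exact: trivalent_iso (proj1 gB) iso triB.
have [f [h' iso']] := type_iso_sym iso; have [_ [h'' hK hK'] _ _ _] := iso'.
have ctrl := contraction_comp (iso_is_contraction iso' hK hK') ctr.
move=> p [x cx <-].
have [x' cx' lift] := degenerates_lift ctrl (closed_point x).
have [y yE] := lift_point cx'.
exists y => //; apply/moduli_embP; exists (set_val (class_type k)), (set_val x).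
have xx := degenerates_refl (cell_pos cx).
by split; [rewrite yE; exact: lift|].
Qed.

(** If an edge is contracted, its target contributes at least 1 to the RH-number of the image. Over
    c that number is 0; on a ray it is 1, but there the source is a second vertex off c and
    contributes as well. *)
Lemma trivalent_contraction A (x : 'rV[R]_(nedge A)) C q h :
  is_type R d A -> closed_cone_point x -> @is_contraction D A (zero_edges x) C q h ->
  trivalent C -> zero_edges x = finset.set0.
Proof.
move=> tA [xge [p pot]] ctr tri; have [x0 [p0 cov]] := tA.
apply/eqP/finset.set0Pn => -[e eZ].
have RHc := RH_contraction hd cov pot xge ctr (q (tgt e)).
have qe : q (src e) = q (tgt e).
  by apply/(ctr_fiber ctr); apply: connect1; exact: adjZ_edge.
have RHe := RH_gt0 hd cov (loc_tgt cov e).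
have rest (P : pred 'I_(nvert A)) : 0 <= \sum_(v | P v) RH_number v.
  by apply: sumr_ge0 => v _; exact: cover_RH_ge0 cov v.
move: RHc; rewrite (bigD1 (tgt e)) //=; have := tri (q (tgt e)).
case lc: (loc (q (tgt e))) => [a|] => [[vc gc]|->]; last first.
  set S := (X in _ + X); have S_ge0 : 0 <= S by exact: rest.
  by move: (RH_number _) S S_ge0 RHe; lia.
rewrite (RH_ray lc) vc gc (bigD1 (src e)) /=; last first.
  by rewrite qe eqxx; apply/eqP => st; have := cover_pot_lt cov e; rewrite st ltxx.
have ls : loc (src e) != None.
  by move: lc; rewrite -qe (ctr_loc ctr); case: ifP => // _ ->.
have := RH_gt0 hd cov ls; set S := (X in _ + (_ + X)).
have S_ge0 : 0 <= S by exact: rest.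
by move: (RH_number (src e)) (RH_number (tgt e)) S S_ge0 RHe; lia.
Qed.

(** Maximal cells are the trivalent ones: every cell lies in the closed image of a trivalent one,
    and if a trivalent cell lies in the closed image of [l], it is a contraction of the type of [l]
    in which no edge is contracted. *)
Lemma moduli_weighted :
  @weighted R (moduli_space R g d D) (type_class R g d D)
    (@moduli_amb R g d D) (@moduli_cell R g d D) (@moduli_emb R g d D) (@moduli_weight R g d D).
Proof.
move=> k; rewrite /moduli_weight.
have -> : isSome (if `[< trivalent (set_val (class_type k)) >] then
   Some (cone_weight R (set_val (class_type k))) else None) =
       `[< trivalent (set_val (class_type k)) >].
  by case: ifP.
split=> [maxk|/asboolP tri l kl].
  by apply/asboolP; have [l tri /maxk <-] := face_of_trivalent k.
have [x0 [p0 cov]] := moduli_type (class_moduli k).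
have [x xE] := lift_point (cone_closed hd (moduli_type (class_moduli k)) (cone_cover hd cov)).
have cx : @moduli_cell R g d D k (set_val x) by rewrite xE; exact: cone_cover hd cov.
have [y _ /moduli_embP[C [z [yz xz]]]] : closed_image l (moduli_emb x) by apply: kl; exists x.
have xz' := degenerates_pos_iso (cell_pos cx) xz.
have [q [h [ctr _]]] := degenerates_iso yz (cover_iso_sym xz').
have Z0 := trivalent_contraction (moduli_type (class_moduli l)) (closed_point y) ctr tri.
rewrite Z0 in ctr; have [f [iso _ _]] := contraction_is_iso ctr.
by apply: class_type_inj; exists q, f.
Qed.

Lemma moduli_pure_dimensional :
  @pure_dimensional R (moduli_space R g d D) (type_class R g d D)
    (@moduli_amb R g d D) (@moduli_cell R g d D) (@moduli_emb R g d D) n.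
Proof.
split=> [k|k m dimk].
  have [l tri kl] := face_of_trivalent k; exists l => //.
  have [x0 [p0 cov]] := moduli_type (class_moduli l).
  have := has_dim_cone hd cov.
  have := card_outer_trivalent tri; rewrite moduli_sum_RH; last by have [] := class_moduli l.
  by move=> [<-].
have [x0 [p0 cov]] := moduli_type (class_moduli k).
rewrite (has_dim_unique dimk (has_dim_cone hd cov)).
have := card_outer_le hd cov; rewrite moduli_sum_RH; last by have [] := class_moduli k.
by rewrite lez_nat.
Qed.

End Moduli.

Local Close Scope quotient_scope.
Local Close Scope ring_scope.
Local Close Scope classical_set_scope.

Theorem theorem2p15 (R : realType) (g d : nat) (D : profile)
    (hd : 1 <= d)
    (hD : forall a, partition_of d (D a))
    (hdim : d + 2 <= nparts D + 2 * g) :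
  @weighted_polyhedral_complex_of_pure_dim R (moduli_space R g d D)
    (type_class R g d D) (@moduli_amb R g d D) (@moduli_cell R g d D)
    (@moduli_emb R g d D) (@moduli_weight R g d D)
    (nparts D + 2 * g - 2 - d).
Proof.
split.
- exact: moduli_polyhedral_complex.
- exact: moduli_weighted.
- exact: moduli_pure_dimensional.
Qed.
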